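(* Let $n\ge 2$ and let $f=(f_1,\dots,f_m)$ with each $f_j\in C^1(\mathbb S^n)$, $j=1,\dots,m$, real-valued, and $\int_{\mathbb S^n}|f(x)|^2d\sigma(x)=1$. Then $$\mathrm V_{x,f}\,\mathrm V_{\nabla_{\mathbb S^n},f}\;\geq\;\frac{n^2}{4}|\tau_f|^4+\mathrm{COV}^2,$$ and this inequality is equivalent to $$\mathrm V_{x,f}\int_{\mathbb S^n}|\nabla_{\mathbb S^n}f(x)|^2d\sigma(x)\;\geq\;\frac{n^2}{4}|\tau_f|^2+\mathrm{COV}^2 .$$
   Context: $\mathbb S^n=\{x=(x_0,\dots,x_n)^T\in\mathbb R^{n+1}:|x|=1\}$ with normalized surface measure $\sigma$. Spherical gradient: for a $C^1$ function $g$ on $\mathbb S^n$, $\nabla_{\mathbb S^n}g=(\Gamma_0g,\dots,\Gamma_ng)^T$ is defined by $\nabla_{\mathbb S^n}g(x)=\nabla G(x)$ for $x\in\mathbb S^n$, where $G(y)=g(y/|y|)$ on $\mathbb R^{n+1}\setminus\{0\}$ and $\nabla$ is the Euclidean gradient in $\mathbb R^{n+1}$. For the row vector $f=(f_1,\dots,f_m)$, $\nabla_{\mathbb S^n}f$ is the $(n+1)\times m$ matrix with entries $\Gamma_kf_j$; $|f|^2=\sum_jf_j^2$; for a matrix $A$, $|A|^2$ is the sum of the squares of its entries. Generalized phase derivative on $\mathbb S^n$: at points where $f(x)\neq0$, $$|\Phi_f'(x)|=\left(\sum_{k=0}^n\sum_{1\leq j<l\leq m}\left(\frac{f_l(x)}{|f(x)|^2}\Gamma_k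 f_j(x)-\frac{f_j(x)}{|f(x)|^2}\Gamma_k f_l(x)\right)^2\right)^{1/2}.$$ Integrands containing the product of a positive power of $|f(x)|$ with $|\Phi_f'(x)|$ are taken to be $0$ where $f(x)=0$. Definitions: - $\tau_f=\int_{\mathbb S^n}x|f(x)|^2d\sigma(x)\in\mathbb R^{n+1}$; - $\mathrm V_{x,f}=\int_{\mathbb S^n}|x-\tau_f|^2|f(x)|^2d\sigma(x)=1-|\tau_f|^2$; - $a(f)=\int_{\mathbb S^n}[\nabla_{\mathbb S^n}f(x)]f^T(x)\,d\sigma(x)\in\mathbb R^{n+1}$ (a column vector); - $\mathrm V_{\nabla_{\mathbb S^n},f}=\int_{\mathbb S^n}|\nabla_{\mathbb S^n}f(x)-a(f)f(x)|^2d\sigma(x)$, where $a(f)f(x)$ is the $(n+1)\times m$ product matrix; - $\mathrm{COV}=\int_{\mathbb S^n}|x-\tau_f|\,|\Phi_f'(x)|\,|f(x)|^2d\sigma(x)$. *)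

(* Defs.v *)
From HB Require Import structures.
From mathcomp Require Import all_boot all_order all_algebra.
From mathcomp Require Import all_classical all_reals all_analysis.
From mathcomp Require Import measurable_realfun.
Import Order.TTheory GRing.Theory Num.Theory.
Import numFieldNormedType.Exports.

Set Implicit Arguments.
Unset Strict Implicit.
Unset Printing Implicit Defensive.

Local Open Scope classical_set_scope.
Local Open Scope ring_scope.

(* Euclidean (Frobenius) norm; the library norm `|A| on matrices is the max
   norm, which induces the same topology but is not the norm wanted here. *)
Definition fnorm (R : realType) (p q : nat) (A : 'M[R]_(p, q)) : R :=
  Num.sqrt (\sum_(i < p) \sum_(j < q) A i j ^+ 2).

(* R^N is 'cV[R]_N, with the product sigma-algebra (that is, the Borel sets),
   constructed as the library does for N.-tuple R. *)
Fact cV_display : measure_display. Proof. exact: default_measure_display. Qed.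

Section measurable_cV.
Context {R : realType} (N : nat).

Let coord (i : 'I_N) (x : 'cV[R]_N) : R := x i ord0.

Let cV_set0 : g_sigma_preimage coord set0.
Proof. exact: sigma_algebra0. Qed.

Let cV_setC A : g_sigma_preimage coord A -> g_sigma_preimage coord (~` A).
Proof. exact: sigma_algebraC. Qed.

Let cV_bigcup (F : _^nat) : (forall i, g_sigma_preimage coord (F i)) ->
  g_sigma_preimage coord (\bigcup_i (F i)).
Proof. exact: sigma_algebra_bigcup. Qed.

HB.instance Definition _ := @isMeasurable.Build cV_display
  'cV[R]_N (g_sigma_preimage coord) cV_set0 cV_setC cV_bigcup.

End measurable_cV.

Section measurable_cV_fun.
Context {R : realType}.

Lemma measurable_coord N (i : 'I_N) :
  measurable_fun [set: 'cV[R]_N] (fun x => x i ord0).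
Proof.
move=> _ Y mY; rewrite setTI; apply: sub_sigma_algebra => /=.
rewrite -bigcup_seq/=; exists i => /=; first by rewrite mem_index_enum.
by exists Y => //; rewrite setTI.
Qed.

Lemma measurable_fun_cVP d (T : measurableType d) N (f : T -> 'cV[R]_N) :
  (forall i, measurable_fun [set: T] (fun x => f x i ord0)) ->
  measurable_fun [set: T] f.
Proof.
move=> mf _ B mB; rewrite setTI; move: B mB.
apply: smallest_sub.
  split.
  - by rewrite preimage_set0; exact: measurable0.
  - by move=> A mA; rewrite setTD preimage_setC; exact: measurableC.
  - by move=> F mF; rewrite preimage_bigcup; exact: bigcupT_measurable.
rewrite -bigcup_seq/= => A [i _] [B mB <-].
by rewrite /= setTI; have := mf i measurableT B mB; rewrite setTI.
Qed.

Lemma measurable_fnorm N : measurable_fun [set: 'cV[R]_N] (@fnorm R N 1).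
Proof.
apply: (@measurableT_comp _ _ _ _ _ _ (@Num.sqrt R)).
  by apply: continuous_measurable_fun; exact: sqrt_continuous.
apply: measurable_sum => i; apply: measurable_sum => j; rewrite (ord1 j).
by apply: measurable_funX; exact: measurable_coord.
Qed.

End measurable_cV_fun.

(* Lebesgue measure on R^N, by induction: the image of
   lebesgue_measure \x (Lebesgue measure on R^N) under (t, x) |-> (t, x)^T *)
Section lebesgue_cV_step.
Context {R : realType} (N : nat).
Variable mu : {sigma_finite_measure set 'cV[R]_N -> \bar R}.

Definition cons_cV (p : R * 'cV[R]_N) : 'cV[R]_N.+1 := col_mx p.1%:M p.2.

Let uncons (x : 'cV[R]_N.+1) : R * 'cV[R]_N := (x ord0 ord0, row' ord0 x).

Let consK : cancel cons_cV uncons.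
Proof.
move=> [t x]; rewrite /uncons /cons_cV; congr pair.
  rewrite (_ : ord0 = lshift N (ord0 : 'I_1)); last exact/val_inj.
  by rewrite (@col_mxEu R 1 N 1) mxE eqxx.
apply/colP => i; rewrite mxE.
rewrite (_ : lift ord0 i = rshift 1 i); last exact/val_inj.
by rewrite (@col_mxEd R 1 N 1).
Qed.

Let unconsK : cancel uncons cons_cV.
Proof.
move=> x; apply/colP => i; rewrite /cons_cV /=.
have [j ->|->] := unliftP ord0 i; last first.
  rewrite (_ : ord0 = lshift N (ord0 : 'I_1)); last exact/val_inj.
  by rewrite (@col_mxEu R 1 N 1) mxE eqxx.
rewrite (_ : lift ord0 j = rshift 1 j); last exact/val_inj.
rewrite (@col_mxEd R 1 N 1) mxE; congr (x _ _); exact/val_inj.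
Qed.

Lemma measurable_cons_cV : measurable_fun [set: R * 'cV[R]_N] cons_cV.
Proof.
apply: measurable_fun_cVP => i.
have [j ->|->] := unliftP ord0 i; last first.
  rewrite (_ : (fun _ => _) = fst)//; apply/funext => p.
  by have /(congr1 fst) := consK p.
rewrite (_ : (fun _ => _) = (fun x : 'cV[R]_N => x j ord0) \o snd).
  by apply: measurableT_comp => //; exact: measurable_coord.
apply/funext => p /=.
by have /(congr1 (fun q : R * 'cV[R]_N => q.2 j ord0))/= := consK p; rewrite mxE.
Qed.

Let measurable_uncons : measurable_fun [set: 'cV[R]_N.+1] uncons.
Proof.
apply: measurable_fun_pair; first exact: measurable_coord.
apply: measurable_fun_cVP => i; rewrite (_ : (fun _ => _) =
  (fun x : 'cV[R]_N.+1 => x (lift ord0 i) ord0)); first exact: measurable_coord.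
by apply/funext => x; rewrite mxE.
Qed.

Definition lebesgue_cons : set 'cV[R]_N.+1 -> \bar R :=
  pushforward (@lebesgue_measure R \x mu)%E cons_cV.

Let lebesgue_cons0 : lebesgue_cons set0 = 0%E.
Proof. by rewrite /lebesgue_cons /pushforward preimage_set0 measure0. Qed.

Let lebesgue_cons_ge0 A : (0 <= lebesgue_cons A)%E.
Proof. by rewrite /lebesgue_cons /pushforward; exact: measure_ge0. Qed.

Let lebesgue_cons_sigma_additive : semi_sigma_additive lebesgue_cons.
Proof.
move=> F mF tF mUF; rewrite /lebesgue_cons /pushforward preimage_bigcup.
apply: measure_semi_sigma_additive.
- by move=> k; rewrite -[X in measurable X]setTI; exact: measurable_cons_cV.
- apply/trivIsetP => /= i j _ _ ij; rewrite -preimage_setI.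
  by move/trivIsetP : tF => /(_ _ _ _ _ ij) ->//; rewrite preimage_set0.
- rewrite -preimage_bigcup -[X in measurable X]setTI.
  exact: measurable_cons_cV.
Qed.

HB.instance Definition _ := isMeasure.Build _ _ _ lebesgue_cons
  lebesgue_cons0 lebesgue_cons_ge0 lebesgue_cons_sigma_additive.

Let lebesgue_cons_sigma_finite : sigma_finite setT lebesgue_cons.
Proof.
have /sigma_finiteP[F [TF ndF Foo]] := sigma_finiteT (@lebesgue_measure R).
have /sigma_finiteP[G [TG ndG Goo]] := sigma_finiteT mu.
exists (fun k => uncons @^-1` (F k `*` G k)).
  rewrite -preimage_bigcup (_ : \bigcup_k _ = setT) ?preimage_setT//.
  apply/seteqP; split => // -[x y] _.
  have [k _ Fkx] : (\bigcup_k F k) x by rewrite -TF.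
  have [l _ Gly] : (\bigcup_k G k) y by rewrite -TG.
  exists (maxn k l) => //; split.
  - by move: x Fkx; exact/subsetPset/ndF/leq_maxl.
  - by move: y Gly; exact/subsetPset/ndG/leq_maxr.
move=> k; have [mF Fk] := Foo k; have [mG Gk] := Goo k; split.
  rewrite -[X in measurable X]setTI; apply: measurable_uncons => //.
  exact: measurableX.
rewrite /lebesgue_cons /pushforward -comp_preimage.
rewrite (_ : uncons \o cons_cV = id); last by apply/funext => p; exact: consK.
rewrite preimage_id [ltLHS]product_measure1E//.
by rewrite lte_mul_pinfty// ge0_fin_numE.
Qed.

HB.instance Definition _ := Measure_isSigmaFinite.Build _ _ _ lebesgue_cons
  lebesgue_cons_sigma_finite.

End lebesgue_cV_step.

Fixpoint lebesgue_cV (R : realType) (N : nat) :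
    {sigma_finite_measure set 'cV[R]_N -> \bar R} :=
  match N with
  | 0 => dirac (0 : 'cV[R]_0)
  | N'.+1 => lebesgue_cons (lebesgue_cV R N')
  end.

Definition sphere (R : realType) (n : nat) : set 'cV[R]_n.+1 :=
  [set x | fnorm x = 1].
Arguments sphere : clear implicits.

Section sphere_measure.
Context (R : realType) (n : nat).

Definition radial_proj (y : 'cV[R]_n.+1) : 'cV[R]_n.+1 := (fnorm y)^-1 *: y.

Definition punctured_ball : set 'cV[R]_n.+1 := [set y | 0 < fnorm y <= 1].

(* Normalized surface measure, as a measure on R^(n+1) carried by the sphere:
   the measure of A is the relative volume, in the unit ball, of the cone
   {t x | x in A, |x| = 1, 0 < t <= 1}. *)
Definition sphere_measure (A : set 'cV[R]_n.+1) : \bar R :=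
  ((fine (lebesgue_cV R n.+1 punctured_ball))^-1%:E *
   lebesgue_cV R n.+1 (punctured_ball `&` radial_proj @^-1` A))%E.

Let measurable_punctured_ball : measurable punctured_ball.
Proof.
rewrite (_ : punctured_ball = @fnorm R n.+1 1 @^-1` `]0, 1]%classic).
  by rewrite -[X in measurable X]setTI; apply: measurable_fnorm.
by apply/seteqP; split => x /=; rewrite in_itv.
Qed.

Let measurable_radial_proj : measurable_fun setT radial_proj.
Proof.
apply: measurable_fun_cVP => i; rewrite (_ : (fun _ => _) =
  (fun x : 'cV[R]_n.+1 => (fnorm x)^-1 * x i ord0)).
  apply: measurable_funM; last exact: measurable_coord.
  rewrite (_ : (fun _ => _) =
      (@powR R ^~ (- 1)) \o (fun x : 'cV[R]_n.+1 => fnorm x)).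
    by apply: measurableT_comp; [exact: measurable_powR|exact: measurable_fnorm].
  by apply/funext => x /=; rewrite powR_inv1// sqrtr_ge0.
by apply/funext => x; rewrite mxE.
Qed.

Let sphere_measure0 : sphere_measure set0 = 0%E.
Proof. by rewrite /sphere_measure preimage_set0 setI0 measure0 mule0. Qed.

Let sphere_measure_ge0 A : (0 <= sphere_measure A)%E.
Proof.
by rewrite mule_ge0// lee_fin invr_ge0 fine_ge0//; exact: measure_ge0.
Qed.

Let sphere_measure_sigma_additive : semi_sigma_additive sphere_measure.
Proof.
move=> F mF tF mUF; rewrite /sphere_measure.
rewrite [X in X @ _ --> _](_ : _ = fun k => ((fine
    (lebesgue_cV R n.+1 punctured_ball))^-1%:E * \sum_(0 <= i < k)
    lebesgue_cV R n.+1 (punctured_ball `&` radial_proj @^-1` F i))%E); last first.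
  apply/funext => k; rewrite ge0_sume_distrr// => i _; exact: measure_ge0.
apply: cvgeZl => //; rewrite preimage_bigcup setI_bigcupr.
have mFi A : measurable A ->
    measurable (punctured_ball `&` radial_proj @^-1` A).
  by move=> mA; apply: measurableI => //;
    rewrite -[X in measurable X]setTI; exact: measurable_radial_proj.
apply: measure_semi_sigma_additive.
- by move=> i; exact: mFi.
- apply/trivIsetP => /= i j _ _ ij; rewrite setIACA -preimage_setI.
  move/trivIsetP : tF => /(_ _ _ _ _ ij) ->//.
  by rewrite preimage_set0 setI0.
- by rewrite -setI_bigcupr -preimage_bigcup; exact: mFi.
Qed.

HB.instance Definition _ := isMeasure.Build _ _ _ sphere_measure
  sphere_measure0 sphere_measure_ge0 sphere_measure_sigma_additive.

End sphere_measure.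
Arguments punctured_ball : clear implicits.
Arguments sphere_measure : clear implicits.

Section spherical_calculus.
Context (R : realType) (n : nat).

(* Functions on the sphere are represented by functions on R^(n+1), of which
   only the values on the sphere are ever used. *)
Definition sphere_int (h : 'cV[R]_n.+1 -> R) : R :=
  \int[sphere_measure R n]_(x in sphere R n) h x.

(* G(y) = g(y / |y|) *)
Definition radial_ext (g : 'cV[R]_n.+1 -> R) : 'cV[R]_n.+1 -> R :=
  fun y => g (radial_proj y).

(* Gamma_k g *)
Definition sgamma (k : 'I_n.+1) (g : 'cV[R]_n.+1 -> R) (x : 'cV[R]_n.+1) : R :=
  'D_(delta_mx k ord0) (radial_ext g) x.

(* g is C^1 on the sphere: G is C^1 on R^(n+1) minus the origin *)
Definition C1_sphere (g : 'cV[R]_n.+1 -> R) : Prop :=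
  forall y, y != 0 -> differentiable (radial_ext g) y /\
    forall k, {for y, continuous (sgamma k g)}.

Context (m : nat) (f : 'cV[R]_n.+1 -> 'rV[R]_m).

Definition comp_fun (j : 'I_m) : 'cV[R]_n.+1 -> R := fun x => f x ord0 j.

Definition sgrad (x : 'cV[R]_n.+1) : 'M[R]_(n.+1, m) :=
  \matrix_(k < n.+1, j < m) sgamma k (comp_fun j) x.

(* Where f x = 0, the value is 0 because x / 0 = 0. *)
Definition phase_deriv (x : 'cV[R]_n.+1) : R :=
  Num.sqrt (\sum_(k < n.+1) \sum_(j < m) \sum_(l < m | (j < l)%N)
    (comp_fun l x / fnorm (f x) ^+ 2 * sgamma k (comp_fun j) x
     - comp_fun j x / fnorm (f x) ^+ 2 * sgamma k (comp_fun l) x) ^+ 2).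

Definition tau : 'cV[R]_n.+1 :=
  \col_(i < n.+1) sphere_int (fun x => x i ord0 * fnorm (f x) ^+ 2).

Definition var_x : R :=
  sphere_int (fun x => fnorm (x - tau) ^+ 2 * fnorm (f x) ^+ 2).

Definition mean_grad : 'cV[R]_n.+1 :=
  \col_(i < n.+1) sphere_int (fun x => (sgrad x *m (f x)^T) i ord0).

Definition var_grad : R :=
  sphere_int (fun x => fnorm (sgrad x - mean_grad *m f x) ^+ 2).

Definition cov : R :=
  sphere_int (fun x => fnorm (x - tau) * phase_deriv x * fnorm (f x) ^+ 2).

End spherical_calculus.

(* Main.v *)
Require Import Defs.
From HB Require Import structures.
From mathcomp Require Import all_boot all_order all_algebra.
From mathcomp Require Import all_classical all_reals all_analysis.
From mathcomp Require Import measurable_realfun ring lra.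
Import Order.TTheory GRing.Theory Num.Theory.
Import numFieldNormedType.Exports.

Local Open Scope classical_set_scope.
Local Open Scope ring_scope.

(** The inequality is a pointwise decomposition of the gradient followed by
    Cauchy-Schwarz; its only analytic input is the divergence theorem on the
    sphere.

    Pointwise part.  Put M = grad f - a f with a = a(f).  Row by row,
    Lagrange's identity splits |M|^2 |f|^2 into |M f^T|^2 and
    (|Phi_f'| |f|^2)^2 ([phase_lagrange]): subtracting a f changes the
    component of the gradient along f and leaves the phase part alone.  With
    D = A^2 + B^2, where A is the integral of (x - tau).(M f^T) and B = COV,
    this gives for all t >= 0
      2 t (A (x - tau).(M f^T) + B |x - tau| |Phi_f'| |f|^2)
        <= t^2 D |x - tau|^2 |f|^2 + |M|^2.
    Integrating yields 2 t D <= t^2 D V_x + V_grad for all t >= 0, hence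
    D <= V_x V_grad ([spherical_uncertainty]).

    Divergence part.  The integral of Gamma_k g is n times that of x_k g
    ([sphere_divergence]).  Applied to g = |f|^2 it gives a(f) = (n/2) tau,
    and together with sum_k x_k Gamma_k f_j = 0 it gives
    A = - (n/2) |tau|^2, which is the first inequality.  The second form
    follows from V_x = 1 - |tau|^2 and
    V_grad = int |grad f|^2 - (n^2/4) |tau|^2.

    The divergence theorem is transferred from R^(n+1), because the surface
    measure is defined by volumes of cones.  Let G(y) = g(y/|y|), which is C^1
    off the origin, and cut it off as H(y) = (s (1 - s))^2 G(y) for
    s = |y|^2 < 1 and H = 0 elsewhere.  Then H is C^1 with support in the unit
    ball and the integral of its k-th partial derivative vanishes
    ([integral_cut_ext_partial]).  In r = |y| that derivative is
      4 (r^3 - 3 r^5 + 2 r^7) (x_k g)(y/r) + (r^3 - 2 r^5 + r^7) (Gamma_k g)(y/r),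
    so only the radial moments int_B r^a h(y/r) dy are needed.  They equal
    N/(N+a) int_B h(y/r) dy with N = n + 1 ([radial_moment]), a consequence of
    the scaling of Lebesgue measure. *)

(** * Euclidean norm and radial projection *)

Section euclidean_norm.
Context {R : realType} {N : nat}.
Implicit Types x y : 'cV[R]_N.

Lemma fnorm_ge0 p q (A : 'M[R]_(p, q)) : 0 <= fnorm A.
Proof. exact: sqrtr_ge0. Qed.

Lemma sqr_fnorm p q (A : 'M[R]_(p, q)) :
  fnorm A ^+ 2 = \sum_(i < p) \sum_(j < q) A i j ^+ 2.
Proof.
by rewrite sqr_sqrtr//; apply: sumr_ge0 => i _; apply: sumr_ge0 => j _;
  exact: sqr_ge0.
Qed.

Lemma sqr_fnorm_cV x : fnorm x ^+ 2 = \sum_(i < N) x i ord0 ^+ 2.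
Proof. by rewrite sqr_fnorm; apply: eq_bigr => i _; rewrite big_ord1. Qed.

Lemma sqr_fnorm_rV (A : 'rV[R]_N) : fnorm A ^+ 2 = \sum_(j < N) A ord0 j ^+ 2.
Proof. by rewrite sqr_fnorm big_ord1. Qed.

Lemma fnormZ a x : fnorm (a *: x) = `|a| * fnorm x.
Proof.
apply/eqP; rewrite -(@eqrXn2 _ 2) ?fnorm_ge0 ?mulr_ge0 ?fnorm_ge0//.
rewrite exprMn real_normK ?num_real// !sqr_fnorm_cV mulr_sumr; apply/eqP.
by apply: eq_bigr => i _; rewrite mxE exprMn.
Qed.

Lemma coord_le_fnorm x i : `|x i ord0| <= fnorm x.
Proof.
rewrite -(@ler_pXn2r _ 2) ?nnegrE ?fnorm_ge0// real_normK ?num_real//.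
rewrite sqr_fnorm_cV (bigD1 i)//= lerDl; apply: sumr_ge0 => j _.
exact: sqr_ge0.
Qed.

Lemma fnorm_eq0 x : (fnorm x == 0) = (x == 0).
Proof.
apply/eqP/eqP => [x0|->]; last first.
  by apply/eqP; rewrite -sqrf_eq0 sqr_fnorm_cV big1// => i _; rewrite mxE expr0n.
apply/colP => i; rewrite mxE; apply/eqP; rewrite -normr_le0 -x0.
exact: coord_le_fnorm.
Qed.

Lemma fnorm_gt0 x : (0 < fnorm x) = (x != 0).
Proof. by rewrite lt_def fnorm_ge0 andbT fnorm_eq0. Qed.

Lemma continuous_sqr_fnorm : continuous (fun x => fnorm x ^+ 2).
Proof.
rewrite (_ : (fun _ => _) = fun x => \sum_(i < N) x i ord0 ^+ 2); last first.
  by apply/funext => x; exact: sqr_fnorm_cV.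
move=> x; apply: (@cvg_big R _ +%R _ _ add_continuous _ (nbhs x)) => i _.
rewrite expr2; under eq_fun do rewrite expr2.
by apply: cvgM; exact: coord_continuous.
Qed.

Lemma continuous_fnorm : continuous (@fnorm R N 1).
Proof.
rewrite (_ : @fnorm R N 1 = Num.sqrt \o (fun x => fnorm x ^+ 2)); last first.
  by apply/funext => x /=; rewrite sqrtr_sqr ger0_norm// fnorm_ge0.
move=> x; apply: continuous_comp; first exact: continuous_sqr_fnorm.
exact: sqrt_continuous.
Qed.

End euclidean_norm.

Section radial_projection.
Context {R : realType} {n : nat}.
Implicit Types x y : 'cV[R]_n.+1.

Lemma radial_projZ a y : 0 < a -> radial_proj (a *: y) = radial_proj y.
Proof.
move=> a0; rewrite /radial_proj fnormZ gtr0_norm// scalerA invfM.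
by rewrite mulrAC mulVf ?mul1r// gt_eqF.
Qed.

Lemma radial_proj_sphere y : y != 0 -> sphere R n (radial_proj y).
Proof.
move=> y0; rewrite /sphere /= /radial_proj fnormZ normrV ?unitfE ?fnorm_eq0//.
by rewrite ger0_norm ?fnorm_ge0// mulVf// fnorm_eq0.
Qed.

Lemma radial_proj_id x : sphere R n x -> radial_proj x = x.
Proof. by rewrite /sphere /radial_proj /= => ->; rewrite invr1 scale1r. Qed.

Lemma sphere_neq0 x : sphere R n x -> x != 0.
Proof. by rewrite /sphere /= -fnorm_gt0 => ->. Qed.

Lemma radial_ext_sphere (g : 'cV[R]_n.+1 -> R) x :
  sphere R n x -> radial_ext g x = g x.
Proof. by move=> Sx; rewrite /radial_ext radial_proj_id. Qed.

Lemma radial_extZ (g : 'cV[R]_n.+1 -> R) a y :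
  0 < a -> radial_ext g (a *: y) = radial_ext g y.
Proof. by move=> a0; rewrite /radial_ext radial_projZ. Qed.

Lemma radial_proj_scale y : y != 0 -> y = fnorm y *: radial_proj y.
Proof.
by move=> y0; rewrite /radial_proj scalerA mulfV ?scale1r// fnorm_eq0.
Qed.

End radial_projection.

(** * Borel sets of R^N *)

Section borel.
Context {R : realType} {N : nat}.

(** The sigma-algebra is generated by the coordinates, so an open set has to be
    written as a countable union of boxes: those with rational centre and
    radius 1/(k+1) that it contains. *)
Lemma open_measurable_cV (U : set 'cV[R]_N) : open U -> measurable U.
Proof.
move=> oU.
pose c (q : 'cV[rat]_N) : 'cV[R]_N := map_mx ratr q.
pose B (p : 'cV[rat]_N * nat) : set 'cV[R]_N :=
  [set x | forall i, `|c p.1 i ord0 - x i ord0| < p.2.+1%:R^-1].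
pose F p : set 'cV[R]_N := if `[< B p `<=` U >] then B p else set0.
rewrite (_ : U = \bigcup_p F p).
  apply: countable_bigcupT_measurable; first exact: countableP.
  move=> p; rewrite /F; case: ifP => // _.
  rewrite (_ : B p = \bigcap_(i in [set: 'I_N])
      ((fun x => x i ord0) @^-1` ball (c p.1 i ord0) p.2.+1%:R^-1)); last first.
    by apply/seteqP; split => x /= h i; [move=> _|]; exact: h.
  apply: fin_bigcap_measurable; first exact: finite_finset.
  move=> i _; rewrite -[X in measurable X]setTI; apply: measurable_coord => //.
  exact: measurable_ball.
apply/seteqP; split => [x Ux|x [p _]]; last first.
  by rewrite /F; case: ifP => //= /asboolP; exact.
have /nbhs_ballP[e /= e0 xeU] : nbhs x U by exact: open_nbhs_nbhs.
have [k ke] : exists k, k.+1%:R^-1 < e / 2.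
  have [k] := ltr_add_invr (divr_gt0 e0 (ltr0n R 2)).
  by rewrite add0r; exists k.
have [d dE d0] : exists2 d : R, d = k.+1%:R^-1 & 0 < d.
  by exists k.+1%:R^-1; rewrite // invr_gt0.
rewrite -dE in ke.
pose q : 'cV[rat]_N := \col_i
  xget 0 [set r | ratr r \in `]x i ord0 - d, x i ord0 + d[ ].
have qP i : `|c q i ord0 - x i ord0| < d.
  rewrite /c /q !mxE; case: xgetP => [r _ /=|].
    by rewrite in_itv/= ltr_norml => /andP[? ?]; apply/andP; split; lra.
  have xd : x i ord0 - d < x i ord0 + d by lra.
  by have [r rP] := rat_in_itvoo xd; move=> /(_ r); rewrite /= rP.
exists (q, k) => //; rewrite /F; case: asboolP => [_|[]].
  by move=> i /=; rewrite -dE; exact: qP.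
move=> y By; apply: xeU; rewrite -ball_normE /= /ball_.
rewrite [ltLHS]/Num.norm /= mx_normrE; apply/bigmax_ltP => /=; split => //.
move=> [i j] _ /=; rewrite (ord1 j) !mxE.
have := qP i; have := By i; rewrite /= -dE !ltr_norml => /andP[? ?] /andP[? ?].
by apply/andP; split; lra.
Qed.

Lemma open_continuous_measurable (U : set 'cV[R]_N) (g : 'cV[R]_N -> R) :
  open U -> {in U, continuous g} -> measurable_fun U g.
Proof.
move=> oU /(continuous_inP _ oU) cg.
apply: (measurability _ (RGenOpens.measurableE R)) => _ [_ [a [b ->] <-]].
by apply: open_measurable_cV; apply: cg; exact: interval_open.
Qed.

End borel.

(** * Homotheties and Lebesgue measure *)

Section integral_mscale.
Context d (T : measurableType d) (R : realType).
Variables (m : {measure set T -> \bar R}) (D : set T) (k : {nonneg R}).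

Lemma integral_mscale (f : T -> \bar R) : measurable D -> m.-integrable D f ->
  (\int[mscale k m]_(x in D) f x = k%:num%:E * \int[m]_(x in D) f x)%E.
Proof.
move=> mD fi; rewrite [LHS]integralE [X in _ = (_ * X)%E]integralE.
have mf := measurable_int _ fi.
rewrite muleBr//; last first.
  by rewrite fin_num_adde_defr//; exact: integrable_pos_fin_num.
by rewrite !ge0_integral_mscale//; [exact: measurable_funeneg|
  exact: measurable_funepos].
Qed.

End integral_mscale.

Section cons_cV.
Context {R : realType} {N : nat}.
Implicit Types (t : R) (x : 'cV[R]_N).

Lemma cons_cV0 t x : cons_cV (t, x) ord0 ord0 = t.
Proof.
rewrite /cons_cV (_ : ord0 = lshift N (ord0 : 'I_1)); last exact/val_inj.
by rewrite (@col_mxEu R 1 N 1) mxE eqxx.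
Qed.

Lemma cons_cVS t x i : cons_cV (t, x) (lift ord0 i) ord0 = x i ord0.
Proof.
rewrite /cons_cV (_ : lift ord0 i = rshift 1 i); last exact/val_inj.
by rewrite (@col_mxEd R 1 N 1).
Qed.

Lemma cons_cVP t x (y : 'cV[R]_N.+1) : y ord0 ord0 = t ->
  (forall i, y (lift ord0 i) ord0 = x i ord0) -> y = cons_cV (t, x).
Proof.
move=> y0 yS; apply/matrixP => i j; rewrite (_ : j = ord0); last exact: ord1.
by have [k ->|->] := unliftP ord0 i; rewrite ?cons_cV0 ?cons_cVS ?y0 ?yS.
Qed.

Lemma cons_cVZ (q : R) t x : q *: cons_cV (t, x) = cons_cV (q * t, q *: x).
Proof. by apply: cons_cVP => [|i]; rewrite mxE ?cons_cV0 ?cons_cVS// mxE. Qed.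

End cons_cV.

Section homothety.
Context {R : realType}.

Lemma lebesgue_measure_homothety (q : R) (A : set R) : 0 < q -> measurable A ->
  lebesgue_measure (( *%R q : measurableTypeR R -> measurableTypeR R) @^-1` A) =
  (q^-1%:E * lebesgue_measure A)%E.
Proof.
move=> q0 mA.
pose s : measurableTypeR R -> measurableTypeR R := *%R q.
have ms : measurable_fun setT s by exact: measurable_funM.
pose nu := mscale (NngNum (ltW q0)) (pushforward lebesgue_measure s).
have -> : lebesgue_measure A = nu ms A.
  apply: lebesgue_measure_unique => //= _ [[a b]] _ <-.
  rewrite /nu /mscale /= /pushforward.
  rewrite (_ : s @^-1` _ = `]a / q, b / q]%classic); last first.
    apply/seteqP; split => x; rewrite /= !in_itv/= /s => /andP[? ?].
      by rewrite ltr_pdivrMr// ler_pdivlMr// mulrC; apply/andP.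
    by rewrite mulrC -ltr_pdivrMr// -ler_pdivlMr//; apply/andP.
  rewrite !lebesgue_measure_itv/= !lte_fin ltr_pM2r ?invr_gt0//.
  case: ifPn => _; last by rewrite mule0.
  by rewrite -!EFinB -EFinM -mulrBl mulrC divfK// gt_eqF.
by rewrite /nu /mscale /= muleA -EFinM mulVf ?mul1e// gt_eqF.
Qed.

Lemma measurable_scaler N (q : R) :
  measurable_fun setT (fun x : 'cV[R]_N => q *: x).
Proof.
apply: measurable_fun_cVP => i; under eq_fun do rewrite mxE.
by apply: measurable_funM => //; exact: measurable_coord.
Qed.

Lemma lebesgue_cVS N (A : set 'cV[R]_N.+1) :
  lebesgue_cV R N.+1 A =
  (@lebesgue_measure R \x lebesgue_cV R N)%E (@cons_cV R N @^-1` A).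
Proof. by []. Qed.

(** Induction on the dimension: a homothety of R^(N+1) is the product of
    homotheties of R and R^N, so the claim follows from uniqueness of the product
    measure. *)
Lemma lebesgue_cV_homothety N (q : R) (A : set 'cV[R]_N) :
  0 < q -> measurable A ->
  lebesgue_cV R N ((fun x => q *: x) @^-1` A) =
  ((q^-1 ^+ N)%:E * lebesgue_cV R N A)%E.
Proof.
move=> q0; elim: N A => [|N IH] A mA.
  rewrite expr0 mul1e; congr (lebesgue_cV R 0 _).
  apply/seteqP; split => x; rewrite /= (_ : q *: x = x)//; apply/colP; by case.
rewrite !lebesgue_cVS.
pose s (p : measurableTypeR R * 'cV[R]_N) : measurableTypeR R * 'cV[R]_N :=
  (q * (p.1 : R), q *: p.2).
have ms : measurable_fun setT s.
  apply: measurable_fun_pair; first exact: measurable_funM.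
  by apply: measurableT_comp; [exact: measurable_scaler|].
have -> : @cons_cV R N @^-1` ((fun x => q *: x) @^-1` A) =
    s @^-1` (@cons_cV R N @^-1` A).
  apply/seteqP; split => -[t x] /=; by rewrite cons_cVZ.
have mB : measurable (@cons_cV R N @^-1` A).
  by rewrite -[X in measurable X]setTI; exact: measurable_cons_cV.
move: (_ @^-1` A) mB => B mB.
have qN0 : 0 <= q ^+ N.+1 by rewrite exprn_ge0 ?ltW.
pose nu := mscale (NngNum qN0)
  (pushforward (@lebesgue_measure R \x lebesgue_cV R N)%E s).
rewrite [X in _ = (_ * X)%E](_ : _ = nu ms B).
  rewrite /nu /mscale /= muleA -EFinM -exprMn mulVf ?expr1n ?mul1e//.
  by rewrite gt_eqF.
apply: (@product_measure_unique _ _ _ _ _ (@lebesgue_measure R)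
  (lebesgue_cV R N) (nu ms)) => // C D mC mD.
transitivity ((q ^+ N.+1)%:E * (@lebesgue_measure R \x lebesgue_cV R N)
  ((( *%R q : measurableTypeR R -> measurableTypeR R) @^-1` C) `*`
   ((fun x => q *: x) @^-1` D)))%E; first by [].
rewrite product_measure1E//; last 2 first.
- by rewrite -[X in measurable X]setTI; exact: (measurable_funM (f:=cst q)).
- by rewrite -[X in measurable X]setTI; exact: measurable_scaler.
rewrite [X in (_ * (X * _))%E](lebesgue_measure_homothety _ _ q0 mC).
rewrite [X in (_ * (_ * X))%E](IH _ mD).
rewrite muleACA [X in (_ * (X * _))%E = _](_ : _ = (q^-1 ^+ N.+1)%:E).
  rewrite muleA [X in (X * _)%E = _](_ : _ = 1%E) ?mul1e//.
  by rewrite -[LHS]EFinM -exprMn mulfV ?gt_eqF// expr1n.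
by rewrite exprS EFinM.
Qed.

Lemma integral_homothety N (q : R) (D : set 'cV[R]_N) (f : 'cV[R]_N -> R) :
  0 < q -> measurable D -> measurable_fun setT f ->
  (lebesgue_cV R N).-integrable D (EFin \o f) ->
  \int[lebesgue_cV R N]_(x in (fun x => q *: x) @^-1` D) f (q *: x) =
  q^-1 ^+ N * \int[lebesgue_cV R N]_(x in D) f x.
Proof.
move=> q0 mD mf fi.
pose s (x : 'cV[R]_N) := q *: x.
have ms : measurable_fun setT s by exact: measurable_scaler.
have qN0 : 0 <= q^-1 ^+ N by rewrite exprn_ge0 ?invr_ge0 ?ltW.
have pE A : measurable A -> pushforward (lebesgue_cV R N) s A =
    mscale (NngNum qN0) (lebesgue_cV R N) A.
  by move=> mA; exact: lebesgue_cV_homothety.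
have fsi : (lebesgue_cV R N).-integrable (s @^-1` D) ((EFin \o f) \o s).
  apply/integrableP; split.
    by apply/measurable_EFinP; apply: measurable_funTS; exact: measurableT_comp.
  have -> : (\int[lebesgue_cV R N]_(x in s @^-1` D) `|((EFin \o f) \o s) x| =
     \int[pushforward (lebesgue_cV R N) s]_(x in D) `|(EFin \o f) x|)%E.
    rewrite ge0_integral_pushforward//.
    apply: measurableT_comp => //; apply/measurable_EFinP.
    exact: measurable_funTS.
  rewrite (eq_measure_integral (mscale (NngNum qN0) (lebesgue_cV R N))).
    rewrite ge0_integral_mscale//; last by apply: measurableT_comp => //;
      exact: measurable_int fi.
    by rewrite lte_mul_pinfty//; case/integrableP : fi.
  by move=> A mA _; exact: pE.
rewrite /Rintegral -[X in fine X = _](@integral_pushforward _ _ _ _ _ s ms _ D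
  (EFin \o f))//; last first.
  exact/measurable_EFinP.
rewrite [X in fine X = _](eq_measure_integral
    (mscale (NngNum qN0) (lebesgue_cV R N))).
  rewrite integral_mscale//= fineM//.
  exact: (@integrable_fin_num _ _ _ _ _ mD (EFin \o f) fi).
by move=> A mA _; exact: pE.
Qed.

End homothety.

(** * The integral of a partial derivative with bounded support *)

Section cube.
Context {R : realType}.

Definition cube N : set 'cV[R]_N := [set x | forall i, `|x i ord0| <= 1].

Lemma measurable_cube N : measurable (cube N).
Proof.
rewrite (_ : cube N = \bigcap_(i in [set: 'I_N])
    ((fun x => x i ord0) @^-1` `[-1, 1]%classic)).
  apply: fin_bigcap_measurable; first exact: finite_finset.
  by move=> i _; rewrite -[X in measurable X]setTI; exact: measurable_coord.
by apply/seteqP; split => x /= xC i; [move=> _|];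
  have := xC i; rewrite ?in_itv/= ?ler_norml//; exact.
Qed.

Lemma cube_cons N t (x : 'cV[R]_N) :
  cube N.+1 (cons_cV (t, x)) <-> `|t| <= 1 /\ cube N x.
Proof.
split => [xC|[t1 xC] i].
  split; first by have := xC ord0; rewrite cons_cV0.
  by move=> i; have := xC (lift ord0 i); rewrite cons_cVS.
by have [j ->|->] := unliftP ord0 i; rewrite ?cons_cV0 ?cons_cVS.
Qed.

Lemma lebesgue_cube N : (lebesgue_cV R N (cube N) < +oo)%E.
Proof.
elim: N => [|N IH].
  by rewrite /= /dirac indicE; case: (_ \in _); rewrite ltry.
rewrite lebesgue_cVS (_ : _ @^-1` _ = `[-1, 1]%classic `*` cube N); last first.
  apply/seteqP; split => -[t x]; first move=> /cube_cons [] t1 xC.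
    by split => //=; rewrite in_itv/= -ler_norml.
  move=> [/= t1 xC]; apply/cube_cons; split => //.
  by rewrite in_itv/= -ler_norml in t1.
rewrite [ltLHS]product_measure1E//; last exact: measurable_cube.
rewrite [X in (X * _)%E](_ : _ = 2%:E).
  by rewrite lte_mul_pinfty// lee_fin.
rewrite [LHS]lebesgue_measure_itv/= lte_fin (lt_trans (ltrN10 _) ltr01).
by rewrite -EFinB opprK.
Qed.

End cube.

Section integral_partial_derivative.
Context {R : realType}.

(** The fundamental theorem of calculus on [-2, 2], whose end points lie in the
    region where F vanishes. *)
Lemma integral_derive_eq0 (F f : R -> R) :
  (forall t : R, is_derive t 1 F (f t)) -> continuous f ->
  (forall t, 1 < `|t| -> F t = 0 /\ f t = 0) ->
  (\int[lebesgue_measure]_t (f t)%:E = 0)%E.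
Proof.
move=> dF cf F0.
have F2 s : `|s| = 2 -> F s = 0.
  move=> s2; have s1 : 1 < `|s| by rewrite s2 ltr1n.
  by have [] := F0 _ s1.
have cF : continuous F.
  by move=> t; apply/differentiable_continuous/derivable1_diffP; have [] := dF t.
transitivity (\int[lebesgue_measure]_(t in `[(- 2 : R)%R, 2%R]) (f t)%:E)%E.
  rewrite [RHS]integral_mkcond; apply: eq_integral => t _; rewrite patchE.
  case: ifPn => //; rewrite notin_setE/= in_itv/= -ler_norml => /negP.
  rewrite -ltNge => t2; have t1 : 1 < `|t| by apply: lt_trans t2; rewrite ltr1n.
  by have [_ ->] := F0 _ t1.
have dLR : derivable_oo_LRcontinuous F (- 2) 2.
  split; first by move=> t _; have [] := dF t.
  - exact/cvg_at_right_filter/cF.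
  - exact/cvg_at_left_filter/cF.
apply: etrans (continuous_FTC2 _ _ dLR _) _; first lra.
- exact: continuous_subspaceT.
- by move=> t _; rewrite derive1E; have [] := dF t.
- by rewrite !F2 ?subee// ?normrN ger0_norm.
Qed.

Lemma integral_lebesgue_cVS N (h : 'cV[R]_N.+1 -> \bar R) :
  measurable_fun setT h ->
  (@lebesgue_measure R \x lebesgue_cV R N)%E.-integrable setT (h \o @cons_cV R N) ->
  (\int[lebesgue_cV R N.+1]_x h x =
   \int[@lebesgue_measure R \x lebesgue_cV R N]_p h (cons_cV p))%E.
Proof.
move=> mh hi.
pose phi : measurableTypeR R * 'cV[R]_N -> 'cV[R]_N.+1 := @cons_cV R N.
have mphi : measurable_fun setT phi by exact: measurable_cons_cV.
have := integral_pushforward (D := setT) mphi mh hi measurableT.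
rewrite preimage_setT => <-.
exact: eq_measure_integral.
Qed.

(** By Fubini, one integrates first along the k-th axis, where the previous
    lemma applies.  Lebesgue measure peels off the coordinate 0 only, so for
    other k the induction hypothesis is used on the slices with coordinate 0
    fixed; this is why all the hypotheses are stated along lines parallel to the
    k-th axis, a form that passes to slices. *)
Lemma integral_partial_eq0 N (k : 'I_N) (H h : 'cV[R]_N -> R) (C : R) :
  measurable_fun setT h -> (forall x, `|h x| <= C) ->
  (forall x, ~ cube N x -> H x = 0 /\ h x = 0) ->
  (forall x (t : R), is_derive t 1 (fun s => H (x + s *: delta_mx k ord0))
                             (h (x + t *: delta_mx k ord0))) ->
  (forall x, continuous (fun t : R => h (x + t *: delta_mx k ord0))) ->
  (\int[lebesgue_cV R N]_x (h x)%:E = 0)%E.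
Proof.
elim: N k H h => [[]//|N IH] k H h mh hC Hh0 dH ch.
have mhc : measurable_fun setT (h \o @cons_cV R N).
  by apply: measurableT_comp => //; exact: measurable_cons_cV.
have hi : (@lebesgue_measure R \x lebesgue_cV R N)%E.-integrable setT
    (EFin \o h \o @cons_cV R N).
  pose D : set (measurableTypeR R * 'cV[R]_N) := @cons_cV R N @^-1` cube N.+1.
  have mD : measurable D.
    rewrite -[X in measurable X]setTI; apply: measurable_cons_cV => //.
    exact: measurable_cube.
  have Doo : ((@lebesgue_measure R \x lebesgue_cV R N) D < +oo)%E.
    exact: (@lebesgue_cube R N.+1).
  have : (@lebesgue_measure R \x lebesgue_cV R N)%E.-integrable D
    (EFin \o (h \o @cons_cV R N)).
    apply: measurable_bounded_integrable => //; first exact: measurable_funTS.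
    exists C; split; first exact: num_real.
    by move=> c Cc x _ /=; apply: le_trans (ltW Cc); exact: hC.
  move=> hD; have := (integrable_mkcond _ mD).1 hD; congr (_.-integrable _ _).
  apply/funext => p; rewrite patchE; case: ifPn => // /=.
  by rewrite notin_setE => /Hh0 [_ ->].
rewrite integral_lebesgue_cVS//; last exact/measurable_EFinP.
have [j kj|k0] := unliftP ord0 k.
- rewrite -integral12_prod_meas1//; apply: integral0_eq => t _ /=.
  rewrite /fubini_F /=.
  have tE x s : cons_cV (t, x) + s *: delta_mx k ord0 =
      cons_cV (t, x + s *: delta_mx j ord0).
    apply: cons_cVP => [|i]; rewrite kj [LHS]mxE ?cons_cV0 ?cons_cVS !mxE.
      by rewrite eqE /= mulr0 addr0.
    by rewrite (inj_eq lift_inj).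
  apply: (IH j (fun x => H (cons_cV (t, x)))) => //.
  + by apply: measurableT_comp mhc _; exact: measurable_fun_pair.
  + move=> x xC; apply: Hh0 => /cube_cons [_]; exact: xC.
  + move=> x s; have := dH (cons_cV (t, x)) s.
    by rewrite tE; under eq_fun do rewrite tE.
  + by move=> x; have := ch (cons_cV (t, x)); under eq_fun do rewrite tE.
- rewrite -integral21_prod_meas1//; apply: integral0_eq => x _ /=.
  rewrite /fubini_G /=.
  have xE s : cons_cV (0, x) + s *: delta_mx k ord0 = cons_cV (s, x).
    apply: cons_cVP => [|i]; rewrite k0 [LHS]mxE ?cons_cV0 ?cons_cVS !mxE.
      by rewrite eqE /= mulr1 add0r.
    by rewrite eqE /= mulr0 addr0.
  apply: (@integral_derive_eq0 (fun t => H (cons_cV (t, x)))) => //.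
  + move=> t; have := dH (cons_cV (0, x)) t.
    by rewrite xE; under eq_fun do rewrite xE.
  + by have := ch (cons_cV (0, x)); under eq_fun do rewrite xE.
  + move=> t t1; apply: Hh0 => /cube_cons [t1' _].
    by move: t1; rewrite ltNge t1'.
Qed.

End integral_partial_derivative.

(** * Spherical integrals as integrals over the ball *)

Section sphere_integral.
Context {R : realType} {n : nat}.
Notation N := n.+1.
Notation mu := (lebesgue_cV R N).
Notation pball := (punctured_ball R n).
Notation S := (sphere R n).

Lemma measurable_punctured_ball : measurable pball.
Proof.
rewrite (_ : pball = @fnorm R N 1 @^-1` `]0, 1]%classic).
  by rewrite -[X in measurable X]setTI; apply: measurable_fnorm.
by apply/seteqP; split => x /=; rewrite in_itv.
Qed.

Lemma measurable_sphere : measurable S.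
Proof.
rewrite (_ : S = @fnorm R N 1 @^-1` [set 1])//.
by rewrite -[X in measurable X]setTI; apply: measurable_fnorm.
Qed.

Lemma measurable_radial_proj : measurable_fun setT (@radial_proj R n).
Proof.
apply: measurable_fun_cVP => i; rewrite /radial_proj.
under eq_fun do rewrite mxE; apply: measurable_funM; last exact: measurable_coord.
under eq_fun do rewrite -powR_inv1 ?fnorm_ge0//.
exact: measurableT_comp (measurable_powR (- 1)) (@measurable_fnorm R N).
Qed.

Lemma punctured_ball_cube : pball `<=` cube N.
Proof.
by move=> x /andP[_ x1] i; apply: le_trans (coord_le_fnorm x i) x1.
Qed.

Lemma lebesgue_punctured_ball : (mu pball < +oo)%E.
Proof.
apply: le_lt_trans (lebesgue_cube N); apply: le_measure; rewrite ?inE//.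
- exact: measurable_punctured_ball.
- exact: measurable_cube.
- exact: punctured_ball_cube.
Qed.

Definition ball_volume : R := fine (mu pball).

Lemma ball_volume_ge0 : 0 <= ball_volume.
Proof. exact/fine_ge0/measure_ge0. Qed.

(** A class of integrands stable under the algebraic operations, on which the
    spherical integral is linear and monotone. *)
Definition sphere_bounded (h : 'cV[R]_N -> R) :=
  measurable_fun S h /\ exists C, forall x, S x -> `|h x| <= C.

Lemma punctured_ball_sphere y : pball y -> S (radial_proj y).
Proof. by move=> /andP[y0 _]; apply: radial_proj_sphere; rewrite -fnorm_gt0. Qed.

Lemma measurable_radial_ext (h : 'cV[R]_N -> R) :
  measurable_fun S h -> measurable_fun pball (radial_ext h).
Proof.
move=> mh; apply: (measurable_comp measurable_sphere _ mh).
  by move=> _ [y yb <-]; exact: punctured_ball_sphere.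
exact: measurable_funTS measurable_radial_proj.
Qed.

Lemma punctured_ball_integrable (k : 'cV[R]_N -> R) (C : R) (D : set 'cV[R]_N) :
  measurable D -> D `<=` pball ->
  measurable_fun D k -> (forall y, D y -> `|k y| <= C) ->
  mu.-integrable D (EFin \o k).
Proof.
move=> mD Db mk kC; apply: measurable_bounded_integrable => //.
  apply: le_lt_trans lebesgue_punctured_ball; apply: le_measure; rewrite ?inE//.
  exact: measurable_punctured_ball.
exists C; split; first exact: num_real.
by move=> c Cc x Dx /=; apply: le_trans (ltW Cc); exact: kC.
Qed.

Lemma radial_ext_integrable (h : 'cV[R]_N -> R) : sphere_bounded h ->
  mu.-integrable pball (EFin \o radial_ext h).
Proof.
move=> [mh [C hC]]; apply: (@punctured_ball_integrable _ C) => //.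
- exact: measurable_punctured_ball.
- exact: measurable_radial_ext.
- by move=> y yb; apply: hC; exact: punctured_ball_sphere.
Qed.

(** The surface measure is the image of the normalized volume of the ball under
    radial projection. *)
Lemma sphere_intE (h : 'cV[R]_N -> R) : sphere_bounded h ->
  sphere_int h = ball_volume^-1 * \int[mu]_(y in pball) radial_ext h y.
Proof.
move=> hb; have [mh _] := hb.
have mb := measurable_punctured_ball.
(* Sending the complement of the ball to the origin, which is not on the
   sphere, makes the preimage of a part of the sphere lie in the ball. *)
pose rho (y : 'cV[R]_N) : 'cV[R]_N := \1_pball y *: radial_proj y.
have mrho : measurable_fun setT rho.
  apply: measurable_fun_cVP => i; rewrite /rho; under eq_fun do rewrite mxE.
  apply: measurable_funM; first exact: measurable_indic.
  exact: measurableT_comp (@measurable_coord R N i) measurable_radial_proj.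
have rhoE y : pball y -> rho y = radial_proj y.
  by move=> yb; rewrite /rho indicE mem_set// scale1r.
have rho0 y : ~ pball y -> rho y = 0.
  by move=> yb; rewrite /rho indicE memNset// scale0r.
have V0 : 0 <= ball_volume^-1 by rewrite invr_ge0 ball_volume_ge0.
have S0 : ~ S 0 by move=> /sphere_neq0; rewrite eqxx.
have rhoS : rho @^-1` S = pball.
  apply/seteqP; split => y /=; last first.
    by move=> yb; rewrite rhoE//; exact: punctured_ball_sphere.
  by have [//|/rho0 ->] := pselect (pball y).
pose h' := h \_ S.
have mh' : measurable_fun setT (EFin \o h').
  by apply/measurable_EFinP; exact: (measurable_restrictT h measurable_sphere).1.
have h'i : mu.-integrable (rho @^-1` S) ((EFin \o h') \o rho).
  rewrite rhoS; move: (radial_ext_integrable _ hb); apply: eq_integrable => // y.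
  rewrite inE => yb; rewrite /= /h' rhoE// patchE mem_set//.
  exact: punctured_ball_sphere.
rewrite /sphere_int (@eq_Rintegral _ _ _ _ _ h'); last first.
  by move=> x xS; rewrite /h' patchE xS.
rewrite [LHS]/Rintegral.
rewrite [X in fine X = _](eq_measure_integral
    (mscale (NngNum V0) (pushforward mu rho))); last first.
  move=> A mA AS; rewrite /= /sphere_measure /mscale /= /pushforward.
  congr (_ * mu _)%E; apply/seteqP; split => y /=.
    by move=> [yb Ay]; rewrite rhoE.
  have [yb|yb] := pselect (pball y); first by rewrite rhoE.
  by rewrite rho0// => /AS /S0.
rewrite integral_mscale//; last first.
- exact: integrable_pushforward mh' h'i measurable_sphere.
- exact: measurable_sphere.
have fineZ (c : R) (z : \bar R) : z \is a fin_num ->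
    fine (c%:E * z) = c * fine z by move=> zf; rewrite fineM.
rewrite [LHS]fineZ; last first.
  apply: (@integrable_fin_num _ _ _ _ _ measurable_sphere (EFin \o h')).
  exact: integrable_pushforward mh' h'i measurable_sphere.
rewrite (integral_pushforward mrho mh' h'i measurable_sphere) rhoS.
congr (_ * fine _); apply: eq_integral => y; rewrite inE => yb.
rewrite /= /h' rhoE// patchE mem_set//; exact: punctured_ball_sphere.
Qed.

End sphere_integral.

(** * Radial moments *)

Section moment.
Context {R : realType} {n : nat}.
Notation N := n.+1.
Notation mu := (lebesgue_cV R N).
Notation pball := (punctured_ball R n).
Notation S := (sphere R n).

Lemma radial_moment_integrable (h : 'cV[R]_N -> R) (a : nat) :
  sphere_bounded h ->
  mu.-integrable pball (EFin \o (fun y => fnorm y ^+ a * radial_ext h y)).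
Proof.
move=> [mh [C hC]].
apply: (@punctured_ball_integrable _ _ _ C) => //.
- exact: measurable_punctured_ball.
- apply: measurable_funM; last exact: measurable_radial_ext.
  by apply: measurable_funX; apply: measurable_funTS; exact: measurable_fnorm.
- move=> y yb; rewrite normrM -[leRHS]mul1r ler_pM//.
    rewrite normrX ger0_norm ?fnorm_ge0// exprn_ile1 ?fnorm_ge0//.
    by case/andP: yb.
  by apply: hC; exact: punctured_ball_sphere.
Qed.

Lemma homothety_punctured_ball (q : R) : 0 < q ->
  (fun y => q^-1 *: y) @^-1` pball = [set y : 'cV[R]_N | 0 < fnorm y <= q].
Proof.
move=> q0; apply/seteqP; split => y /=; rewrite /punctured_ball /= fnormZ
  gtr0_norm ?invr_gt0// pmulr_rgt0 ?invr_gt0// mulrC ler_pdivrMr ?mul1r//.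
Qed.

(** The integrand is homogeneous of degree a and the volume of degree N. *)
Lemma radial_moment_homothety (h : 'cV[R]_N -> R) (a : nat) (q : R) :
  sphere_bounded h -> 0 < q ->
  \int[mu]_(y in [set y | 0 < fnorm y <= q]) (fnorm y ^+ a * radial_ext h y) =
  q ^+ (N + a) * \int[mu]_(y in pball) (fnorm y ^+ a * radial_ext h y).
Proof.
move=> hb q0.
pose k y := fnorm y ^+ a * radial_ext h y.
have mb := measurable_punctured_ball (R := R) (n := n).
have ki : mu.-integrable pball (EFin \o k) by exact: radial_moment_integrable.
have mk : measurable_fun pball k by exact/measurable_EFinP/measurable_int/ki.
have mk' := (measurable_restrictT k mb).1 mk.
have k'E y : pball y -> (k \_ pball) y = k y by move=> yb; rewrite patchE mem_set.
have qi : 0 < q^-1 by rewrite invr_gt0.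
pose k' y := q ^+ a * (k \_ pball) y.
have mk'' : measurable_fun setT k' by exact: measurable_funM.
have k'i : mu.-integrable pball (EFin \o k').
  apply/(eq_integrable mb (fun y => (q ^+ a)%:E * (EFin \o k) y)%E).
    by move=> y; rewrite inE => yb; rewrite /k' /= k'E// EFinM.
  exact: integrableZl.
have := integral_homothety N q^-1 pball k' qi mb mk'' k'i.
rewrite homothety_punctured_ball// invrK => E.
transitivity (\int[mu]_(y in [set y | 0 < fnorm y <= q]) k' (q^-1 *: y)).
  apply: eq_Rintegral => y; rewrite -homothety_punctured_ball// inE /= => yb.
  rewrite /k' k'E// /k fnormZ gtr0_norm// radial_extZ// exprMn !mulrA.
  by rewrite -exprMn mulfV ?gt_eqF// expr1n mul1r.
rewrite E exprD -mulrA; congr (_ * _); rewrite -RintegralZl//.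
by apply: eq_Rintegral => y; rewrite inE /k' => yb; rewrite k'E.
Qed.

Lemma measurable_annulus (q : R) : measurable [set y : 'cV[R]_N | q < fnorm y <= 1].
Proof.
rewrite (_ : mkset _ = @fnorm R N 1 @^-1` `]q, 1]%classic).
  by rewrite -[X in measurable X]setTI; apply: measurable_fnorm.
by apply/seteqP; split => x /=; rewrite in_itv.
Qed.

Lemma radial_moment_annulus (h : 'cV[R]_N -> R) (a : nat) (q : R) :
  sphere_bounded h -> 0 < q < 1 ->
  \int[mu]_(y in [set y | q < fnorm y <= 1]) (fnorm y ^+ a * radial_ext h y) =
  (1 - q ^+ (N + a)) * \int[mu]_(y in pball) (fnorm y ^+ a * radial_ext h y).
Proof.
move=> hb /andP[q0 q1].
rewrite mulrBl mul1r -radial_moment_homothety//.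
have bE : pball = [set y | 0 < fnorm y <= q] `|` [set y | q < fnorm y <= 1].
  apply/seteqP; split => y /=; rewrite /punctured_ball /=.
    by move=> /andP[y0 y1]; case: (lerP (fnorm y) q) => yq; [left|right];
      apply/andP.
  move=> [/andP[y0 yq]|/andP[yq y1]]; apply/andP; split => //.
    exact: le_trans yq (ltW q1).
  exact: lt_trans q0 yq.
rewrite [in RHS]bE Rintegral_setU.
- by rewrite addrAC subrr add0r.
- rewrite -homothety_punctured_ball// -[X in measurable X]setTI.
  by apply: measurable_scaler => //; exact: measurable_punctured_ball.
- exact: measurable_annulus.
- by rewrite -bE; exact: radial_moment_integrable.
- apply/disj_setPS => y [/= /andP[_ yq] /andP[qy _]].
  by move: (lt_le_trans qy yq); rewrite ltxx.
Qed.

(** Let X be the moment and Y the integral without weight.  On the annulus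
    q < |y| <= 1 the integrals are (1 - q^(N+a)) X and (1 - q^N) Y by
    homogeneity, while the integrands differ by at most 1 - q^a times a bound of
    h.  Dividing by 1 - q and letting q tend to 1 gives (N + a) X = N Y. *)
Lemma radial_moment (h : 'cV[R]_N -> R) (a : nat) : sphere_bounded h ->
  \int[mu]_(y in pball) (fnorm y ^+ a * radial_ext h y) =
  N%:R / (N + a)%:R * \int[mu]_(y in pball) radial_ext h y.
Proof.
move=> hb; have [mh [C hC]] := hb.
set X := \int[mu]_(y in pball) (fnorm y ^+ a * radial_ext h y).
set Y := \int[mu]_(y in pball) radial_ext h y.
pose V : R := ball_volume (R := R) (n := n).
(* sg k q = (1 - q^k)/(1 - q), extended to q = 1 by continuity *)
pose sg (k : nat) (q : R) := \sum_(i < k) q ^+ i.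
have key q : 0 < q < 1 ->
    `|sg (N + a)%N q * X - sg N q * Y| <= (1 - q ^+ a) * (sg N q * (C * V)).
  move=> /[dup] q01 /andP[q0 q1].
  have q1' : 0 < 1 - q by rewrite subr_gt0.
  have sgE k : 1 - q ^+ k = (1 - q) * sg k q.
    by rewrite -opprB subrX1 -mulNr opprB.
  have mA := measurable_annulus q.
  set A := [set y | q < fnorm y <= 1] in mA.
  have Ab : A `<=` pball.
    move=> y /andP[qy y1]; apply/andP; split => //; exact: lt_trans q0 qy.
  pose k (y : 'cV[R]_N) := fnorm y ^+ a * radial_ext h y.
  have ki : mu.-integrable A (EFin \o k).
    apply: (integrableS measurable_punctured_ball mA Ab).
    exact: radial_moment_integrable.
  have hi : mu.-integrable A (EFin \o radial_ext h).
    apply: (integrableS measurable_punctured_ball mA Ab).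
    exact: radial_ext_integrable.
  have XE : \int[mu]_(y in A) k y = (1 - q) * (sg (N + a)%N q * X).
    by rewrite mulrA -sgE -radial_moment_annulus.
  have annulus0 h0 : sphere_bounded h0 -> \int[mu]_(y in A) radial_ext h0 y =
      (1 - q) * (sg N q * \int[mu]_(y in pball) radial_ext h0 y).
    move=> h0b; have := radial_moment_annulus h0 0 q h0b q01.
    rewrite addn0 sgE mulrA => E.
    rewrite (@eq_Rintegral _ _ _ mu A (fun y => fnorm y ^+ 0 * radial_ext h0 y)).
      rewrite E; congr (_ * _); apply: eq_Rintegral => y _.
      by rewrite expr0 mul1r.
    by move=> y _; rewrite expr0 mul1r.
  have VE : \int[mu]_(y in A) 1 = (1 - q) * (sg N q * V).
    rewrite (annulus0 (cst 1)).
      rewrite /radial_ext /= Rintegral_cst ?mul1r//.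
      exact: measurable_punctured_ball.
    by split; [exact: measurable_cst|exists 1 => x _; rewrite normr1].
  have dE : (1 - q) * (sg (N + a)%N q * X - sg N q * Y) =
      \int[mu]_(y in A) (k y - radial_ext h y).
    by rewrite RintegralB// XE annulus0// mulrBr.
  have di : mu.-integrable A (EFin \o (fun y => k y - radial_ext h y)).
    apply: (eq_integrable mA ((EFin \o k) \- (EFin \o radial_ext h))%E) => //.
    exact: integrableB.
  have C0 : 0 <= C.
    pose e : 'cV[R]_N := delta_mx ord0 ord0.
    have eS : S e.
      apply/eqP; rewrite -(@eqrXn2 _ 2) ?fnorm_ge0// sqr_fnorm_cV.
      rewrite (bigD1 ord0)//= big1 ?addr0.
        by rewrite mxE !eqxx.
      by move=> i i0; rewrite mxE (negbTE i0) expr0n.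
    exact: le_trans (normr_ge0 (h e)) (hC _ eS).
  rewrite -(ler_pM2l q1') -{1}(gtr0_norm q1') -normrM dE.
  apply: le_trans (le_normr_Rintegral mA di) _.
  rewrite (_ : (1 - q) * _ = \int[mu]_(y in A) ((1 - q ^+ a) * C)).
    apply: le_Rintegral => //.
    + exact: integrable_norm.
    + apply: (@punctured_ball_integrable _ _ _ ((1 - q ^+ a) * C)) => //.
      by move=> y _; rewrite ger0_norm// mulr_ge0// subr_ge0 exprn_ile1 ?ltW.
    + move=> y Ay; have /andP[qy y1] := Ay.
      rewrite /k -[X in `|_ - X|]mul1r -mulrBl normrM ler_pM//.
        rewrite distrC ger0_norm.
          by rewrite lerD2l lerN2 lerXn2r ?nnegrE ?fnorm_ge0 ?ltW.
        by rewrite subr_ge0 exprn_ile1 ?fnorm_ge0.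
      by apply: hC; apply: punctured_ball_sphere; exact: Ab.
  transitivity ((1 - q ^+ a) * C * \int[mu]_(y in A) 1).
    by rewrite VE; ring.
  by rewrite !Rintegral_cst// mul1r.
have sg1 k : sg k 1 = k%:R.
  rewrite /sg (eq_bigr (fun=> 1)) => [|i _]; last by rewrite expr1n.
  by rewrite sumr_const card_ord.
have csg k : continuous (sg k).
  rewrite (_ : sg k = horner (\poly_(i < k) 1)); last first.
    apply/funext => q; rewrite horner_poly; apply: eq_bigr => i _.
    by rewrite mul1r.
  exact: continuous_horner.
pose g q := (1 - q ^+ a) * (sg N q * (C * V)) - `|sg (N + a)%N q * X - sg N q * Y|.
have g1 : 0 <= g 1.
  have cg : g q @[q --> 1^'-] --> g 1.
    apply: cvg_at_left_filter; apply: cvgB.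
      apply: cvgM; last by apply: cvgM; [exact: csg|exact: cvg_cst].
      by apply: cvgB; [exact: cvg_cst|exact: exprn_continuous].
    apply: cvg_norm; apply: cvgB; apply: cvgM; try exact: cvg_cst; exact: csg.
  rewrite -(cvg_lim _ cg)//; apply: limr_ge; first by apply/cvg_ex; exists (g 1).
  near=> q; rewrite subr_ge0; apply: key; apply/andP; split; near: q.
  - exact: nbhs_left_gt.
  - exact: nbhs_left_lt.
have : (N + a)%:R * X - N%:R * Y = 0.
  apply/eqP; rewrite -normr_le0; move: g1.
  by rewrite /g !sg1 expr1n subrr mul0r sub0r oppr_ge0.
move=> /subr0_eq XY; apply: (@mulfI _ (N + a)%:R); first by rewrite pnatr_eq0 addSn.
by rewrite XY mulrCA mulrA mulfVK ?pnatr_eq0// mulrC.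
Unshelve. all: by end_near.
Qed.

End moment.

(** * Bounded integrands on the sphere *)

Section sphere_bounded_algebra.
Context {R : realType} {n : nat}.
Notation N := n.+1.
Notation S := (sphere R n).
Implicit Types f g h : 'cV[R]_N -> R.

Lemma sphere_bounded_cst (a : R) : sphere_bounded (fun _ : 'cV[R]_N => a).
Proof. by split; [exact: measurable_cst|exists `|a|]. Qed.

Lemma sphere_bounded_coord i : sphere_bounded (fun x : 'cV[R]_N => x i ord0).
Proof.
split; first exact: measurable_funTS (measurable_coord i).
by exists 1 => x Sx; rewrite -Sx; exact: coord_le_fnorm.
Qed.

Lemma sphere_boundedD f g :
  sphere_bounded f -> sphere_bounded g -> sphere_bounded (fun x => f x + g x).
Proof.
move=> [mf [Cf fC]] [mg [Cg gC]]; split; first exact: measurable_funD.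
exists (Cf + Cg) => x Sx; apply: le_trans (ler_normD _ _) _.
by rewrite lerD ?fC ?gC.
Qed.

Lemma sphere_boundedM f g :
  sphere_bounded f -> sphere_bounded g -> sphere_bounded (fun x => f x * g x).
Proof.
move=> [mf [Cf fC]] [mg [Cg gC]]; split; first exact: measurable_funM.
by exists (Cf * Cg) => x Sx; rewrite normrM ler_pM ?fC ?gC.
Qed.

Lemma sphere_boundedZ a f :
  sphere_bounded f -> sphere_bounded (fun x => a * f x).
Proof. exact/sphere_boundedM/sphere_bounded_cst. Qed.

Lemma sphere_boundedB f g :
  sphere_bounded f -> sphere_bounded g -> sphere_bounded (fun x => f x - g x).
Proof.
move=> fb gb; under eq_fun do rewrite -mulN1r.
by apply: sphere_boundedD => //; exact: sphere_boundedZ.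
Qed.

Lemma sphere_boundedX f k :
  sphere_bounded f -> sphere_bounded (fun x => f x ^+ k).
Proof.
move=> fb; elim: k => [|k IH].
  under eq_fun do rewrite expr0; exact: sphere_bounded_cst.
by under eq_fun do rewrite exprS; exact: sphere_boundedM.
Qed.

Lemma sphere_bounded_sum (I : finType) (P : pred I) (F : I -> 'cV[R]_N -> R) :
  (forall i, P i -> sphere_bounded (F i)) ->
  sphere_bounded (fun x => \sum_(i | P i) F i x).
Proof.
move=> Fb; rewrite (_ : (fun _ => _) =
    (fun x => \sum_(i <- index_enum I) (if P i then F i x else 0))); last first.
  by apply/funext => x; rewrite big_mkcond.
elim: (index_enum I) => [|i s IH].
  by under eq_fun do rewrite big_nil; exact: sphere_bounded_cst.
under eq_fun do rewrite big_cons; apply: sphere_boundedD => //.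
by case: (boolP (P i)) => [/Fb|_] //; exact: sphere_bounded_cst.
Qed.

Lemma eq_sphere_bounded f g : (forall x, S x -> f x = g x) ->
  sphere_bounded f -> sphere_bounded g.
Proof.
move=> fg [mf [C fC]]; split; last by exists C => x Sx; rewrite -fg// fC.
by apply: eq_measurable_fun mf => x; rewrite inE; exact: fg.
Qed.

Lemma sphere_bounded_le f g : measurable_fun S f -> sphere_bounded g ->
  (forall x, S x -> `|f x| <= g x) -> sphere_bounded f.
Proof.
move=> mf [_ [C gC]] fg; split=> //; exists C => x Sx.
by apply: le_trans (fg _ Sx) (le_trans (ler_norm _) (gC _ Sx)).
Qed.

Lemma sphere_bounded_integrable f : sphere_bounded f ->
  (sphere_measure R n).-integrable S (EFin \o f).
Proof.
move=> [mf [C fC]]; apply: measurable_bounded_integrable => //.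
- exact: measurable_sphere.
- have mb := @measurable_punctured_ball R n.
  rewrite /= /sphere_measure lte_mul_pinfty//.
    by rewrite lee_fin invr_ge0; exact: ball_volume_ge0.
  apply: le_lt_trans (lebesgue_punctured_ball (R := R) (n := n)).
  apply: le_measure; rewrite ?inE//; apply: measurableI => //.
  rewrite -[X in measurable X]setTI; apply: measurable_radial_proj => //.
  exact: measurable_sphere.
- exists C; split; first exact: num_real.
  by move=> c Cc x Sx /=; apply: le_trans (ltW Cc); exact: fC.
Qed.

Lemma eq_sphere_int f g : (forall x, S x -> f x = g x) ->
  sphere_int f = sphere_int g.
Proof. by move=> fg; apply: eq_Rintegral => x; rewrite inE; exact: fg. Qed.

Lemma sphere_intD f g : sphere_bounded f -> sphere_bounded g ->
  sphere_int (fun x => f x + g x) = sphere_int f + sphere_int g.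
Proof.
move=> fb gb; rewrite /sphere_int RintegralD//; first exact: measurable_sphere.
all: exact: sphere_bounded_integrable.
Qed.

Lemma sphere_intZ a f : sphere_bounded f ->
  sphere_int (fun x => a * f x) = a * sphere_int f.
Proof.
move=> fb; rewrite /sphere_int RintegralZl//; first exact: measurable_sphere.
exact: sphere_bounded_integrable.
Qed.

Lemma sphere_intB f g : sphere_bounded f -> sphere_bounded g ->
  sphere_int (fun x => f x - g x) = sphere_int f - sphere_int g.
Proof.
move=> fb gb; rewrite /sphere_int RintegralB//; first exact: measurable_sphere.
all: exact: sphere_bounded_integrable.
Qed.

Lemma sphere_int_sum (I : finType) (F : I -> 'cV[R]_N -> R) :
  (forall i, sphere_bounded (F i)) ->
  sphere_int (fun x => \sum_i F i x) = \sum_i sphere_int (F i).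
Proof.
move=> Fb; elim: (index_enum I) => [|i s IH].
  under eq_sphere_int do rewrite big_nil.
  by rewrite big_nil /sphere_int Rintegral_cst ?mul0r//; exact: measurable_sphere.
under eq_sphere_int do rewrite big_cons.
rewrite big_cons sphere_intD ?IH//.
elim: s {IH} => [|j s IH].
  by under eq_fun do rewrite big_nil; exact: sphere_bounded_cst.
by under eq_fun do rewrite big_cons; exact: sphere_boundedD.
Qed.

Lemma le_sphere_int f g : sphere_bounded f -> sphere_bounded g ->
  (forall x, S x -> f x <= g x) -> sphere_int f <= sphere_int g.
Proof.
move=> fb gb fg; apply: le_Rintegral => //; first exact: measurable_sphere.
all: exact: sphere_bounded_integrable.
Qed.

Lemma sphere_bounded_sqrt (h : 'cV[R]_N -> R) :
  sphere_bounded h -> sphere_bounded (fun x => Num.sqrt (h x)).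
Proof.
move=> hb; have [mh _] := hb.
apply: (@sphere_bounded_le _ (fun x => 1 + h x ^+ 2)).
- apply: measurableT_comp mh; apply: continuous_measurable_fun.
  exact: sqrt_continuous.
- by apply: sphere_boundedD; [exact: sphere_bounded_cst|exact: sphere_boundedX].
- move=> x _; rewrite ger0_norm ?sqrtr_ge0//.
  have [h0|h0] := leP 0 (h x); last by rewrite ltr0_sqrtr// addr_ge0 ?sqr_ge0.
  rewrite -[X in _ <= 1 + X ^+ 2](sqr_sqrtr h0).
  move: (Num.sqrt _) (sqrtr_ge0 (h x)) => s s0.
  have [s1|s1] := leP s 1.
    by apply: le_trans s1 _; rewrite lerDl sqr_ge0.
  have : s ^+ 1 <= s ^+ 4 by rewrite ler_eXn2l.
  by rewrite expr1 -exprM => s4; apply: le_trans s4 _; rewrite lerDr.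
Qed.

Lemma lincomb_bounded (c : 'I_N -> R) (F : 'I_N -> 'cV[R]_N -> R) :
  (forall k, sphere_bounded (F k)) ->
  sphere_bounded (fun x => \sum_k c k * F k x).
Proof. by move=> Fb; apply: sphere_bounded_sum => k _; exact: sphere_boundedZ. Qed.

Lemma sphere_int_lincomb (c : 'I_N -> R) (F : 'I_N -> 'cV[R]_N -> R) :
  (forall k, sphere_bounded (F k)) ->
  sphere_int (fun x => \sum_k c k * F k x) = \sum_k c k * sphere_int (F k).
Proof.
move=> Fb; rewrite sphere_int_sum => [|k]; last exact: sphere_boundedZ.
by apply: eq_bigr => k _; rewrite sphere_intZ.
Qed.

End sphere_bounded_algebra.

Section C1_sphere_bounded.
Context {R : realType} {n : nat}.
Notation N := n.+1.
Notation S := (sphere R n).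
Implicit Types g : 'cV[R]_N -> R.

Lemma open_neq0 : open [set y : 'cV[R]_N | y != 0].
Proof.
rewrite (_ : mkset _ = @fnorm R N 1 @^-1` [set r | 0 < r]).
  by apply: open_comp; [move=> y _; exact: continuous_fnorm|exact: open_gt].
by apply/seteqP; split => y /=; rewrite fnorm_gt0.
Qed.

Lemma continuous_trmx (p q : nat) : continuous (@trmx R p q).
Proof.
move=> A.
apply: (@cvgrPdist_lt _ _ _ (nbhs A) _ (@trmx R p q) A^T).2 => e e0.
apply/nbhs_ballP; exists e => //= B; rewrite -ball_normE /=; apply: le_lt_trans.
rewrite (_ : A^T - B^T = (A - B)^T); last by rewrite linearB.
rewrite [leLHS]/Num.norm /= mx_normrE; apply/bigmax_leP => /=; split => //.
move=> [i j] _ /=; rewrite mxE [leRHS]/Num.norm /= mx_normrE.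
by apply/bigmax_geP; right => /=; exists (j, i).
Qed.

Lemma compact_sphere : compact S.
Proof.
pose T : set 'rV[R]_N := [set v | fnorm v^T = 1].
have -> : S = trmx @` T.
  apply/seteqP; split => [x Sx|_ [v vT <-]]//.
  by exists x^T; rewrite ?trmxK// /T /= trmxK.
apply: continuous_compact.
  by apply: continuous_subspaceT; exact: continuous_trmx.
apply: bounded_closed_compact.
  exists 1; split; first exact: num_real.
  move=> c c1 v vT /=; apply: le_trans (ltW c1).
  rewrite [leLHS]/Num.norm /= mx_normrE; apply/bigmax_leP => /=; split => //.
  move=> [i j] _ /=; rewrite (ord1 i) -vT.
  by apply: le_trans (coord_le_fnorm _ j); rewrite mxE.
rewrite (_ : T = (@fnorm R N 1 \o trmx) @^-1` [set 1])//.
apply: closed_comp; last exact: closed_eq.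
move=> v _; apply: continuous_comp; first exact: continuous_trmx.
exact: continuous_fnorm.
Qed.

Lemma sphere_nonempty : S !=set0.
Proof.
exists (radial_proj (delta_mx ord0 ord0)); apply: radial_proj_sphere.
by apply/eqP => /matrixP/(_ ord0 ord0)/eqP; rewrite !mxE !eqxx oner_eq0.
Qed.

(** A continuous function is bounded on the sphere by compactness. *)
Lemma continuous_sphere_bounded g :
  (forall y : 'cV[R]_N, y != 0 -> {for y, continuous g}) -> sphere_bounded g.
Proof.
move=> cg; split.
  apply: (measurable_funS (open_measurable_cV _ open_neq0)).
    by move=> x; exact: sphere_neq0.
  apply: open_continuous_measurable; first exact: open_neq0.
  by move=> y /set_mem y0; apply: cg.
have cng : {within S, continuous (fun x => `|g x|)}.
  apply: continuous_in_subspaceT => x; rewrite inE => /sphere_neq0 x0.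
  exact: cvg_norm (cg x x0).
have [c _ cP] := compact_EVT_max sphere_nonempty compact_sphere cng.
by exists `|g c| => x Sx; apply: cP; rewrite inE.
Qed.

Lemma C1_sphere_bounded g : C1_sphere g -> sphere_bounded g.
Proof.
move=> g1; apply: (@eq_sphere_bounded _ _ (radial_ext g)).
  by move=> x Sx; rewrite radial_ext_sphere.
apply: continuous_sphere_bounded => y y0.
by apply: differentiable_continuous; have [] := g1 y y0.
Qed.

Lemma sgamma_bounded g k : C1_sphere g -> sphere_bounded (sgamma k g).
Proof.
by move=> g1; apply: continuous_sphere_bounded => y y0; have [_] := g1 y y0; exact.
Qed.

End C1_sphere_bounded.

(** * Differentiation of homogeneous extensions *)

Section derivatives.
Context {R : realType}.

Lemma is_derive_line N (F : 'cV[R]_N -> R) (x e : 'cV[R]_N) (t d : R) :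
  is_derive (x + t *: e) e F d -> is_derive t 1 (fun u : R => F (x + u *: e)) d.
Proof.
have E : (fun h : R => h^-1 *: (((fun u : R => F (x + u *: e)) \o shift t) (h *: 1) -
     F (x + t *: e))) =
   (fun h : R => h^-1 *: ((F \o shift (x + t *: e)) (h *: e) - F (x + t *: e))).
  apply/funext => h /=; congr (_ *: (F _ - _)).
  by rewrite addrCA -scalerDl /GRing.scale /= mulr1.
move=> [dF Fd]; split; first by rewrite /derivable E.
by rewrite -Fd /derive E.
Qed.

(** Serves to differentiate a cut-off function at the points where the cut-off
    takes over: a function of the order of the square of a differentiable
    function is flat at the zeros of the latter. *)
Lemma is_derive0_sqr_bound (F q : R -> R) (C t dq : R) :
  is_derive t 1 q dq -> q t = 0 -> (forall u, `|F u| <= C * q u ^+ 2) ->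
  is_derive t 1 F 0.
Proof.
move=> [dq' dqE] qt FC.
have Ft : F t = 0.
  by apply/eqP; rewrite -normr_le0; have := FC t; rewrite qt expr0n mulr0.
pose dif (f : R -> R) (h : R) : R := h^-1 *: ((f \o shift t) (h *: 1) - f t).
have cq : dif q @ 0^' --> dq by rewrite -dqE; exact: dq'.
suff c0 : dif F @ 0^' --> 0 by split; [apply/cvg_ex; exists 0|exact: cvg_lim].
apply/norm_cvg0P.
apply: (@squeeze_cvgr _ _ _ _ (fun=> 0) (fun h : R => C * (`|h| * dif q h ^+ 2))).
- near=> h; rewrite normr_ge0 /= /dif Ft qt !subr0 /GRing.scale /= mulr1.
  have [->|h0] := eqVneq h 0; first by rewrite invr0 !mul0r normr0 !mul0r mulr0.
  rewrite normrM exprMn [leRHS](_ : _ = `|h^-1| * (C * q (h + t) ^+ 2)).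
    by rewrite ler_wpM2l.
  have -> : h^-1 ^+ 2 = `|h^-1| * `|h^-1|.
    by rewrite -expr2 real_normK ?num_real.
  have hh : `|h| * `|h^-1| = 1 by rewrite -normrM mulfV// normr1.
  transitivity ((`|h| * `|h^-1|) * (`|h^-1| * (C * q (h + t) ^+ 2))); first by ring.
  by rewrite hh mul1r.
- exact: cvg_cst.
- rewrite [X in _ --> X](_ : _ = C * (`|0 : R| * dq ^+ 2)); last first.
    by rewrite normr0 mul0r mulr0.
  apply: cvgM; first exact: cvg_cst.
  apply: cvgM.
    by apply: cvg_norm; apply: cvg_within_filter; exact: cvg_id.
  by rewrite expr2; under eq_fun do rewrite expr2; exact: cvgM.
Unshelve. all: by end_near.
Qed.

End derivatives.

Section homogeneity.
Context {R : realType} {n : nat}.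
Notation N := n.+1.
Notation S := (sphere R n).
Variables (g : 'cV[R]_N -> R).
Hypothesis g1 : C1_sphere g.

(** The partial derivatives of a function homogeneous of degree 0 are
    homogeneous of degree -1. *)
Lemma sgamma_homogeneous (k : 'I_N) (y : 'cV[R]_N) : y != 0 ->
  radial_ext (sgamma k g) y = fnorm y * sgamma k g y.
Proof.
move=> y0.
have r0 : 0 < fnorm y by rewrite fnorm_gt0.
have p0 : radial_proj y != 0 by apply: sphere_neq0; exact: radial_proj_sphere.
pose z := radial_proj y; pose G := radial_ext g; pose e : 'cV[R]_N := delta_mx k ord0.
have [dz _] := g1 _ p0.
have [dy _] := g1 _ y0.
rewrite /radial_ext /sgamma -/z -/G -/e.
pose r := fnorm y.
have yE : y = r *: z by rewrite -radial_proj_scale.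
have Gr u : G (y + u *: e) = G (z + (r^-1 * u) *: e).
  rewrite yE /G -(radial_extZ g r (z + (r^-1 * u) *: e))// scalerDr.
  rewrite [r *: (_ *: e)]scalerA.
  by rewrite mulrA mulfV ?mul1r// gt_eqF.
have lz : is_derive (0 : R) 1 (fun u : R => G (z + u *: e)) ('D_e G z).
  by apply: is_derive_line; rewrite scale0r addr0; apply: derivableP;
    exact: diff_derivable.
have ly : is_derive (0 : R) 1 (fun u : R => G (y + u *: e)) ('D_e G y).
  by apply: is_derive_line; rewrite scale0r addr0; apply: derivableP;
    exact: diff_derivable.
have lr : is_derive (0 : R) 1 (fun u : R => r^-1 * u) r^-1.
  by apply: is_derive_eq; rewrite /GRing.scale /= mulr1 ?mulr0 ?addr0.
have lz' : is_derive (r^-1 * 0 : R) 1 (fun u : R => G (z + u *: e)) ('D_e G z).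
  by rewrite mulr0.
have [_ cE] := is_derive1_comp lz' lr.
have [_ dE] := ly.
have fE : (fun u : R => G (y + u *: e)) =
    (fun u : R => G (z + u *: e)) \o (fun u : R => r^-1 * u).
  by apply/funext => u; exact: Gr.
by rewrite -dE fE cE mulrCA mulfV ?mulr1// gt_eqF.
Qed.

(** The left-hand side is the derivative of the radial extension in the radial
    direction, along which it is constant. *)
Lemma sgamma_radial (x : 'cV[R]_N) : x != 0 ->
  \sum_k x k ord0 * sgamma k g x = 0.
Proof.
move=> x0; have [dx _] := g1 _ x0.
pose G := radial_ext g.
have -> : \sum_k x k ord0 * sgamma k g x = 'D_x G x.
  have xE : \sum_k x k ord0 *: delta_mx k ord0 = x.
    rewrite [RHS]matrix_sum_delta; apply: eq_bigr => k _.
    by rewrite big_ord1.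
  rewrite deriveE//; transitivity ('d G x (\sum_k x k ord0 *: delta_mx k ord0)).
    rewrite linear_sum; apply: eq_bigr => k _.
    by rewrite linearZ /= /sgamma deriveE.
  by rewrite xE.
rewrite /derive; apply/cvg_lim => //; apply: cvg_near_cst.
near=> h; rewrite /= /G (_ : h *: x + x = (h + 1) *: x); last first.
  by rewrite scalerDl scale1r.
rewrite radial_extZ ?subrr ?scaler0//.
near: h; apply: cvg_within.
have : \forall h \near (0 : R), -1 < h by apply: lt_nbhsr; rewrite ltrN10.
by apply: filterS => h; rewrite -subr_gt0 opprK.
Unshelve. all: by end_near.
Qed.

End homogeneity.

(** * The cut-off extension *)

Section cutoff.
Context {R : realType} {n : nat}.
Notation N := n.+1.
Notation S := (sphere R n).
Variables (g : 'cV[R]_N -> R) (k : 'I_N).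
Hypothesis g1 : C1_sphere g.
Let G := radial_ext g.
Let e : 'cV[R]_N := delta_mx k ord0.

Definition sqn (y : 'cV[R]_N) : R := fnorm y ^+ 2.
(** The square of this polynomial is the cut-off.  It vanishes to second order
    at the unit sphere, which makes the extension by 0 differentiable there, and
    to fourth order at the origin, which absorbs the singularity of the radial
    extension and of its gradient. *)
Definition shell (y : 'cV[R]_N) : R := sqn y * (1 - sqn y).
Definition cut_ext (y : 'cV[R]_N) : R :=
  if sqn y < 1 then shell y ^+ 2 * G y else 0.
Definition cut_ext_partial (y : 'cV[R]_N) : R :=
  if sqn y < 1 then
    4 * (shell y * (1 - 2 * sqn y) * y k ord0) * G y + shell y ^+ 2 * sgamma k g y
  else 0.

Lemma sqn_ge0 y : 0 <= sqn y. Proof. exact: sqr_ge0. Qed.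

Lemma sqn_eq0 y : (sqn y == 0) = (y == 0).
Proof. by rewrite /sqn sqrf_eq0 fnorm_eq0. Qed.

Lemma shell0 : shell 0 = 0.
Proof. by rewrite /shell (_ : sqn 0 = 0) ?mul0r//; apply/eqP; rewrite sqn_eq0. Qed.

Lemma sqn_line x t : sqn (x + t *: e) = sqn x + 2 * t * x k ord0 + t ^+ 2.
Proof.
rewrite /sqn !sqr_fnorm_cV (bigD1 k)//= [in RHS](bigD1 k)//= !mxE !eqxx /= mulr1.
rewrite (eq_bigr (fun i => x i ord0 ^+ 2)) => [|i ik]; first ring.
by rewrite !mxE (negbTE ik) /= mulr0 addr0.
Qed.

Lemma shell_line x (t : R) : is_derive t 1 (fun u : R => shell (x + u *: e))
  (2 * (x + t *: e) k ord0 * (1 - 2 * sqn (x + t *: e))).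
Proof.
rewrite (_ : (fun u => _) = fun u : R => (sqn x + 2 * u * x k ord0 + u ^+ 2) *
  (1 - (sqn x + 2 * u * x k ord0 + u ^+ 2))); last first.
  by apply/funext => u; rewrite /shell sqn_line.
rewrite sqn_line !mxE !eqxx /= mulr1.
apply: is_derive_eq.
by rewrite /GRing.scale /=; ring.
Qed.

Lemma continuous_sqn : continuous sqn.
Proof. exact: continuous_sqr_fnorm. Qed.

Lemma continuous_shell : continuous shell.
Proof.
by move=> y; exact: cvgM (continuous_sqn y) (cvgB (cvg_cst _) (continuous_sqn y)).
Qed.

Lemma shell_neq0 y : shell y != 0 -> y != 0.
Proof. by apply: contra => /eqP ->; rewrite shell0. Qed.

(** Only |y| Gamma_k g(y), of degree 0, is bounded near the origin; one factor
    of the cut-off pays for the missing |y| and the other one remains. *)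
Lemma cut_ext_partial_bound :
  exists C, forall y, `|cut_ext y| <= C * shell y ^+ 2 /\
    `|cut_ext_partial y| <= C * `|shell y| /\ `|cut_ext_partial y| <= C.
Proof.
have [_ [Cg gC]] := C1_sphere_bounded g g1.
have [_ [Cd dC]] := sgamma_bounded g k g1.
have [x0 Sx0] := @sphere_nonempty R n.
have Cg0 : 0 <= Cg := le_trans (normr_ge0 _) (gC _ Sx0).
have Cd0 : 0 <= Cd := le_trans (normr_ge0 _) (dC _ Sx0).
have C0 : 0 <= 4 * Cg + Cd by rewrite addr_ge0// mulr_ge0.
exists (4 * Cg + Cd) => y.
have [->|y0] := eqVneq y 0.
  rewrite /cut_ext /cut_ext_partial shell0 expr0n !mul0r !mulr0 !mul0r addr0.
  by case: ifP; rewrite normr0 !mulr0; split=> //; split.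
have SG : `|G y| <= Cg by apply: gC; exact: radial_proj_sphere.
have Sd : fnorm y * `|sgamma k g y| <= Cd.
  rewrite -[X in X * _](ger0_norm (fnorm_ge0 _ _ y)) -normrM -sgamma_homogeneous//.
  by apply: dC; exact: radial_proj_sphere.
rewrite /cut_ext /cut_ext_partial; case: ifPn => [s1|_]; last first.
  by rewrite normr0; split; [|split] => //; apply: mulr_ge0 => //; exact: sqr_ge0.
have s0 := sqn_ge0 y.
have r1 : fnorm y <= 1.
  rewrite -(@ler_pXn2r _ 2) ?nnegrE ?fnorm_ge0// expr1n; exact: ltW.
have b0 : 0 <= shell y by rewrite mulr_ge0// subr_ge0 ltW.
have b1 : shell y <= 1.
  by rewrite /shell mulr_ile1// ?subr_ge0 ?gerBl// ltW.
have bd : shell y * `|sgamma k g y| <= Cd.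
  apply: le_trans Sd; rewrite ler_wpM2r// /shell.
  rewrite -[leRHS]mulr1; apply: ler_pM => //.
  - by rewrite subr_ge0 ltW.
  - by rewrite /sqn expr2 ler_piMr// fnorm_ge0.
  - by rewrite gerBl.
have main : `|4 * (shell y * (1 - 2 * sqn y) * y k ord0) * G y +
     shell y ^+ 2 * sgamma k g y| <= (4 * Cg + Cd) * `|shell y|.
  rewrite (ger0_norm b0) [leRHS]mulrDl; apply: le_trans (ler_normD _ _) _.
  apply: lerD.
    rewrite 4!normrM (ger0_norm b0) (ger0_norm (ler0n R 4)).
    have yk1 : `|y k ord0| <= 1 := le_trans (coord_le_fnorm _ _) r1.
    have ss : `|1 - 2 * sqn y| <= 1 by rewrite ler_norml; apply/andP; split; lra.
    have : `|1 - 2 * sqn y| * `|y k ord0| <= 1 by rewrite mulr_ile1.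
    have := normr_ge0 (G y).
    have : 0 <= `|1 - 2 * sqn y| * `|y k ord0| by rewrite mulr_ge0.
    rewrite -(mulrA (shell y)); move: (_ * `|y k ord0|) => w w0 G0 w1.
    rewrite (_ : 4 * (shell y * w) * `|G y| = 4 * (w * `|G y|) * shell y); last by ring.
    rewrite ler_wpM2r// ler_wpM2l// (le_trans _ SG)//.
    by rewrite ler_piMl.
  rewrite normrM ger0_norm ?sqr_ge0// expr2 -mulrA mulrC ler_wpM2r//.
split; last first.
  split; first exact: main.
  by apply: le_trans main _; rewrite (ger0_norm b0) ler_piMr.
rewrite normrM ger0_norm ?sqr_ge0// mulrC ler_wpM2r ?sqr_ge0//.
by apply: le_trans SG _; lra.
Qed.

Lemma near_sqn_lt1 y : sqn y < 1 -> \forall z \near y, sqn z < 1.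
Proof. by move=> s1; exact: (cvgr_lt (sqn y) (continuous_sqn y) _ s1). Qed.

Lemma near_sqn_gt1 y : 1 < sqn y -> \forall z \near y, 1 < sqn z.
Proof. by move=> s1; exact: (cvgr_gt (sqn y) (continuous_sqn y) _ s1). Qed.

Lemma shell_cases y : [\/ shell y = 0, (shell y != 0) /\ sqn y < 1 | 1 < sqn y].
Proof.
have [|b0] := eqVneq (shell y) 0; first by constructor 1.
have [s1|s1|s1] := ltgtP (sqn y) 1; [by constructor 2|by constructor 3|].
by move: b0; rewrite /shell s1 subrr mulr0 eqxx.
Qed.

Lemma cut_ext_shell0 y : shell y = 0 -> cut_ext y = 0 /\ cut_ext_partial y = 0.
Proof.
have [C yC] := cut_ext_partial_bound; have [y1 [y2 _]] := yC y.
move=> b0; move: y1 y2; rewrite b0 expr0n normr0 !mulr0 !normr_le0.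
by move=> /eqP -> /eqP ->.
Qed.

Lemma continuous_line (x : 'cV[R]_N) : continuous (fun t : R => x + t *: e).
Proof.
by move=> t; exact: cvgD (cvg_cst _) (cvgZ cvg_id (cvg_cst _)).
Qed.

(** At the zeros of the cut-off polynomial, that is at the origin and on the
    unit sphere, the quadratic bound replaces the product rule. *)
Lemma cut_ext_derive x (t : R) : is_derive t 1 (fun u : R => cut_ext (x + u *: e))
  (cut_ext_partial (x + t *: e)).
Proof.
have [C yC] := cut_ext_partial_bound.
have [b0|[b0 s1]|s1] := shell_cases (x + t *: e).
- have [_ ->] := cut_ext_shell0 _ b0.
  apply: (is_derive0_sqr_bound _ _ C _ _ (shell_line x t) b0) => u.
  by have [] := yC (x + u *: e).
- have [dG _] := g1 _ (shell_neq0 _ b0).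
  apply: (@near_eq_is_derive _ _ _
      ((fun u : R => shell (x + u *: e)) ^+ 2 * (fun u : R => G (x + u *: e)))).
    near=> u; rewrite /cut_ext ifT//; near: u.
    exact: (continuous_line x t _ (near_sqn_lt1 _ s1)).
  have dl : is_derive t 1 (fun u : R => G (x + u *: e)) (sgamma k g (x + t *: e)).
    by apply: is_derive_line; apply: derivableP; exact: diff_derivable.
  have db := shell_line x t.
  apply: is_derive_eq; rewrite /cut_ext_partial s1 /GRing.scale /=.
  by rewrite exprfctE; ring.
- apply: (@near_eq_is_derive _ _ _ (cst 0)).
    near=> u; rewrite /cut_ext ifF//; apply/negbTE; rewrite -leNgt ltW//; near: u.
    exact: (continuous_line x t _ (near_sqn_gt1 _ s1)).
  rewrite /cut_ext_partial ifF; first exact: is_derive_cst.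
  by apply/negbTE; rewrite -leNgt ltW.
Unshelve. all: by end_near.
Qed.

Lemma continuous_cut_ext_partial : continuous cut_ext_partial.
Proof.
have [C yC] := cut_ext_partial_bound.
move=> y.
have [b0|[b0 s1]|s1] := shell_cases y.
- rewrite /continuous_at; have [_ ->] := cut_ext_shell0 _ b0.
  apply: (@norm_cvg0P _ _ _ (nbhs y) _ cut_ext_partial).1.
  apply: (@squeeze_cvgr _ (nbhs y) _ _ (fun=> 0) (fun y => C * `|shell y|)).
  + by near=> z; rewrite normr_ge0 /=; have [_ []] := yC z.
  + exact: cvg_cst.
  + rewrite [X in _ --> X](_ : _ = C * `|shell y|); last by rewrite b0 normr0 mulr0.
    apply: cvgM; first exact: cvg_cst.
    by apply: cvg_norm; exact: continuous_shell.
- have [dG cd] := g1 _ (shell_neq0 _ b0).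
  pose F y := 4 * (shell y * (1 - 2 * sqn y) * y k ord0) * G y +
    shell y ^+ 2 * sgamma k g y.
  have FE : \forall z \near y, F z = cut_ext_partial z.
    by near=> z; rewrite /cut_ext_partial ifT//; near: z; exact: near_sqn_lt1.
  rewrite /continuous_at {2}/cut_ext_partial s1.
  apply: cvg_trans (near_eq_cvg FE) _; rewrite /F.
  apply: cvgD; apply: cvgM.
  + apply: cvgM; first exact: cvg_cst.
    apply: cvgM; last exact: coord_continuous.
    apply: cvgM; first exact: continuous_shell.
    apply: cvgB; first exact: cvg_cst.
    by apply: cvgM; [exact: cvg_cst|exact: continuous_sqn].
  + exact: differentiable_continuous.
  + rewrite expr2; under eq_fun do rewrite expr2.
    by apply: cvgM; exact: continuous_shell.
  + exact: cd.
- rewrite /continuous_at {2}/cut_ext_partial ifF; last first.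
    by apply/negbTE; rewrite -leNgt ltW.
  apply: (@cvg_near_cst _ _ _ _ (nbhs y)).
  near=> z; rewrite /cut_ext_partial ifF//.
  by apply/negbTE; rewrite -leNgt ltW//; near: z; exact: near_sqn_gt1.
Unshelve. all: by end_near.
Qed.

Lemma integral_cut_ext_partial :
  (\int[lebesgue_cV R N]_x (cut_ext_partial x)%:E = 0)%E.
Proof.
have [C yC] := cut_ext_partial_bound.
apply: (@integral_partial_eq0 _ _ k cut_ext cut_ext_partial C).
- apply: open_continuous_measurable; first exact: openT.
  by move=> y _; exact: continuous_cut_ext_partial.
- by move=> x; have [_ []] := yC x.
- move=> x xC; rewrite /cut_ext /cut_ext_partial.
  case: ifPn => // s1; exfalso; apply: xC => i.
  apply: le_trans (coord_le_fnorm x i) _.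
  by rewrite -(@ler_pXn2r _ 2) ?nnegrE ?fnorm_ge0// expr1n; exact: ltW.
- exact: cut_ext_derive.
- move=> x t.
  exact: (cvg_comp _ _ (continuous_line x t) (continuous_cut_ext_partial _)).
Qed.

End cutoff.

(** * The divergence theorem on the sphere *)

Section divergence.
Context {R : realType} {n : nat}.
Notation N := n.+1.
Notation mu := (lebesgue_cV R N).
Notation pball := (punctured_ball R n).

Definition coef_poly (c : seq R) (r : R) : R := \sum_(a < size c) c`_a * r ^+ a.

Lemma coef_poly_rcons c x r :
  coef_poly (rcons c x) r = coef_poly c r + x * r ^+ size c.
Proof.
rewrite /coef_poly size_rcons big_ord_recr /= nth_rcons ltnn eqxx.
by congr (_ + _); apply: eq_bigr => i _; rewrite nth_rcons ltn_ord.
Qed.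

Lemma radial_poly_moment (h : 'cV[R]_N -> R) (c : seq R) : sphere_bounded h ->
  mu.-integrable pball (EFin \o (fun y => coef_poly c (fnorm y) * radial_ext h y)) /\
  \int[mu]_(y in pball) (coef_poly c (fnorm y) * radial_ext h y) =
  (\sum_(a < size c) c`_a * (N%:R / (N + a)%:R)) *
  \int[mu]_(y in pball) radial_ext h y.
Proof.
move=> hb; have mb := @measurable_punctured_ball R n.
elim/last_ind: c => [|c x [qi qE]].
  have E y : coef_poly [::] (fnorm y) * radial_ext h y = 0.
    by rewrite /coef_poly big_ord0 mul0r.
  split.
    apply: (eq_integrable mb (cst 0%E)); last exact: integrable0.
    by move=> y _; rewrite /= E.
  rewrite big_ord0 mul0r (eq_Rintegral mu (g := cst 0)); last by move=> y _; exact: E.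
  by rewrite Rintegral_cst// mul0r.
have mi := radial_moment_integrable h (size c) hb.
have xi : mu.-integrable pball
    (EFin \o (fun y => x * (fnorm y ^+ size c * radial_ext h y))).
  pose k (y : 'cV[R]_N) := (fnorm y ^+ size c * radial_ext h y)%:E.
  apply: (eq_integrable mb (fun y => x%:E * k y)%E); last exact: integrableZl.
  by move=> y _; rewrite /= EFinM.
have sE y : coef_poly (rcons c x) (fnorm y) * radial_ext h y =
    coef_poly c (fnorm y) * radial_ext h y + x * (fnorm y ^+ size c * radial_ext h y).
  by rewrite coef_poly_rcons mulrDl mulrA.
split.
  by under [X in (EFin \o X)]eq_fun do rewrite sE; exact: (integrableD mb qi xi).
under eq_Rintegral do rewrite sE.
rewrite RintegralD// qE RintegralZl// radial_moment// size_rcons.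
rewrite big_ord_recr /= nth_rcons ltnn eqxx mulrDl mulrA; congr (_ * _ + _).
by apply: eq_bigr => i _; rewrite nth_rcons ltn_ord.
Qed.

(** The derivative of the cut-off extension is a combination of the radial
    extensions of x_k g and Gamma_k g with polynomial weights in |y|.  Its
    integral vanishes, and the moments of the weights are
    - 8 n N/((N+3)(N+5)(N+7)) for x_k g and 8 N/((N+3)(N+5)(N+7)) for
    Gamma_k g. *)
Lemma sphere_divergence (g : 'cV[R]_N -> R) (k : 'I_N) : C1_sphere g ->
  sphere_int (sgamma k g) = n%:R * sphere_int (fun x => x k ord0 * g x).
Proof.
move=> g1.
have mb := @measurable_punctured_ball R n.
have gb := sgamma_bounded g k g1.
have xb : sphere_bounded (fun x : 'cV[R]_N => x k ord0 * g x).
  by apply: sphere_boundedM; [exact: sphere_bounded_coord|exact: C1_sphere_bounded].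
rewrite !sphere_intE// mulrCA; congr (_ * _).
set X1 := \int[_]_(_ in _) _; set X0 := \int[_]_(_ in _) _.
(* the coefficients of 4 (r^3 - 3 r^5 + 2 r^7) and r^3 - 2 r^5 + r^7 *)
have [i0 E0] := radial_poly_moment _ [:: 0; 0; 0; 4; 0; - 12; 0; 8] xb.
have [i1 E1] := radial_poly_moment _ [:: 0; 0; 0; 1; 0; - 2; 0; 1] gb.
have : \int[mu]_(y in pball) cut_ext_partial g k y = 0.
  rewrite Rintegral_mkcond [X in Rintegral _ _ X](_ : _ = cut_ext_partial g k).
    by rewrite /Rintegral integral_cut_ext_partial.
  apply/funext => y; rewrite patchE; case: ifPn => //; rewrite notin_setE => yb.
  rewrite /cut_ext_partial; case: ifPn => // y1.
  have -> : y = 0.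
    apply/eqP; apply/negPn/negP => y0; apply: yb.
    rewrite /punctured_ball /= fnorm_gt0 y0 /=.
    by rewrite -(@ler_pXn2r _ 2) ?nnegrE ?fnorm_ge0// expr1n ltW.
  by rewrite shell0 expr0n /= !mul0r mulr0 !mul0r addr0.
rewrite (@eq_Rintegral _ _ _ _ _ (fun y =>
  coef_poly [:: 0; 0; 0; 4; 0; - 12; 0; 8] (fnorm y) *
     radial_ext (fun x : 'cV[R]_N => x k ord0 * g x) y +
  coef_poly [:: 0; 0; 0; 1; 0; - 2; 0; 1] (fnorm y) *
     radial_ext (sgamma k g) y)); last first.
  move=> y; rewrite inE => /andP[y0 y1].
  have yn0 : y != 0 by rewrite -fnorm_gt0.
  rewrite /coef_poly /= !big_ord_recr !big_ord0 /=.
  rewrite sgamma_homogeneous// /cut_ext_partial /shell /sqn.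
  have -> : radial_ext (fun x : 'cV[R]_N => x k ord0 * g x) y =
      (fnorm y)^-1 * y k ord0 * radial_ext g y by rewrite /radial_ext mxE.
  rewrite -/(radial_ext g y) !expr0 !expr1.
  have [s1|s1] := ltP (fnorm y ^+ 2) 1.
    by field; exact: lt0r_neq0.
  have -> : fnorm y = 1.
    apply/eqP; rewrite eq_le y1 /= -(@ler_pXn2r _ 2) ?nnegrE ?fnorm_ge0//.
    by rewrite expr1n.
  by rewrite !expr1n; ring.
rewrite RintegralD// E0 E1 -/X0 -/X1.
rewrite /= !big_ord_recr !big_ord0 /= !natrD -natr1.
have n0 : 0 <= n%:R :> R := ler0n R n.
move: (n%:R) n0 => t t0.
rewrite [X in X = _ -> _](_ : _ =
    8 * (t + 1) / ((t + 4) * (t + 6) * (t + 8)) * (X1 - t * X0)).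
  move=> /eqP; rewrite mulf_eq0 subr_eq0 => /orP[|/eqP//].
  by rewrite gt_eqF// divr_gt0 ?mulr_gt0//; lra.
by field; rewrite !lt0r_neq0//; lra.
Qed.

End divergence.

(** * Lagrange's identity *)

Section lagrange.
Context {R : realType}.

Lemma sum_ltn_symmetric m (E : 'I_m -> 'I_m -> R) :
  (forall i, E i i = 0) -> (forall i j, E i j = E j i) ->
  \sum_i \sum_j E i j = 2 * \sum_(i : 'I_m) \sum_(j : 'I_m | (i < j)%N) E i j.
Proof.
move=> E0 Es.
rewrite (eq_bigr (fun i : 'I_m => \sum_(j : 'I_m | (i < j)%N) E i j +
    \sum_(j : 'I_m | (j < i)%N) E i j)).
  rewrite big_split /= mulr_natl mulr2n; congr (_ + _).
  rewrite (exchange_big_dep xpredT)//=.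
  by apply: eq_bigr => i _; apply: eq_bigr => j _.
move=> i _; rewrite (bigID (fun j : 'I_m => (i < j)%N))/=; congr (_ + _).
rewrite [LHS](bigD1 i) ?ltnn//= E0 add0r; apply: eq_bigl => j.
by rewrite -leqNgt ltn_neqAle andbC (inj_eq val_inj).
Qed.

Lemma lagrange_identity m (x y : 'I_m -> R) :
  (\sum_i x i ^+ 2) * (\sum_i y i ^+ 2) =
  (\sum_i x i * y i) ^+ 2 +
  \sum_(i : 'I_m) \sum_(j : 'I_m | (i < j)%N) (y j * x i - y i * x j) ^+ 2.
Proof.
apply: (@mulfI _ 2) => //; rewrite mulrDr -sum_ltn_symmetric; last 2 first.
- by move=> i; rewrite subrr expr0n.
- by move=> i j; rewrite -sqrrN opprB.
have -> : \sum_i \sum_j (y j * x i - y i * x j) ^+ 2 =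
    (\sum_i x i ^+ 2) * (\sum_j y j ^+ 2) + (\sum_i y i ^+ 2) * (\sum_j x j ^+ 2)
    - 2 * ((\sum_i x i * y i) * (\sum_j x j * y j)).
  rewrite !big_distrlr /= mulr_sumr -big_split -sumrB; apply: eq_bigr => i _.
  rewrite /= mulr_sumr -big_split -sumrB; apply: eq_bigr => j _ /=; ring.
ring.
Qed.

Lemma cauchy_schwarz_sum m (x y : 'I_m -> R) :
  (\sum_i x i * y i) ^+ 2 <= (\sum_i x i ^+ 2) * (\sum_i y i ^+ 2).
Proof.
rewrite lagrange_identity lerDl; apply: sumr_ge0 => i _; apply: sumr_ge0 => j _.
exact: sqr_ge0.
Qed.

(** The sum of 2 X u <= X^2 d^2 + c with X = s A and
    2 Y d z <= Y^2 d^2 + z^2 with Y = s B. *)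
Lemma coupling_bound (s A B d c u z : R) :
  0 <= c -> u ^+ 2 <= d ^+ 2 * c ->
  2 * s * (A * u + B * (d * z)) <=
  s ^+ 2 * (A ^+ 2 + B ^+ 2) * d ^+ 2 + (c + z ^+ 2).
Proof.
move=> c0 ud.
have h1 : 2 * (s * A) * u <= (s * A) ^+ 2 * d ^+ 2 + c.
  move: (s * A) => X; have [d0|d0] := eqVneq d 0.
    move: ud; rewrite d0 expr0n mul0r mulr0 add0r => u0.
    have -> : u = 0 by apply/eqP; rewrite -sqrf_eq0 eq_le u0 sqr_ge0.
    by rewrite mulr0.
  have d2 : 0 < d ^+ 2 by rewrite exprn_even_gt0.
  rewrite -(ler_pM2l d2) -subr_ge0.
  apply: (@le_trans _ _ ((X * d ^+ 2 - u) ^+ 2)); first exact: sqr_ge0.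
  rewrite -subr_ge0 (_ : _ - _ = d ^+ 2 * c - u ^+ 2) ?subr_ge0//; ring.
have h2 : 0 <= (s * B * d - z) ^+ 2 by exact: sqr_ge0.
rewrite -subr_ge0 (_ : _ - _ = ((s * A) ^+ 2 * d ^+ 2 + c - 2 * (s * A) * u) +
  (s * B * d - z) ^+ 2); last by ring.
by rewrite addr_ge0// subr_ge0.
Qed.

End lagrange.

(** * The uncertainty inequality *)

Section uncertainty.
Context {R : realType} {n m : nat}.
Notation N := n.+1.
Notation S := (sphere R n).
Variable f : 'cV[R]_N -> 'rV[R]_m.
Hypothesis hf : forall j, C1_sphere (comp_fun f j).
Hypothesis hf1 : sphere_int (fun x => fnorm (f x) ^+ 2) = 1.

Let fj (j : 'I_m) := comp_fun f j.
Let sq (x : 'cV[R]_N) : R := fnorm (f x) ^+ 2.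
Let T := tau f.
Let a := mean_grad f.
Let fgrad (k : 'I_N) (x : 'cV[R]_N) : R := \sum_j fj j x * sgamma k (fj j) x.

Lemma sqE x : sq x = \sum_j fj j x ^+ 2.
Proof. exact: sqr_fnorm_rV. Qed.

Lemma sq_eq0 x j : sq x = 0 -> fj j x = 0.
Proof.
move=> /eqP; rewrite sqE psumr_eq0 => [|i _]; last exact: sqr_ge0.
by move=> /allP/(_ j (mem_index_enum j)); rewrite sqrf_eq0 => /eqP.
Qed.

Lemma radial_ext_sq : radial_ext sq = \sum_(j < m) radial_ext (fj j) ^+ 2.
Proof.
apply/funext => y; rewrite fct_sumE /radial_ext sqE.
by apply: eq_bigr => j _; rewrite exprfctE.
Qed.

Lemma sq_is_derive k y : y != 0 ->
  is_derive y (delta_mx k ord0) (radial_ext sq)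
    (\sum_(j < m) 2 * radial_ext (fj j) y * sgamma k (fj j) y).
Proof.
move=> y0; rewrite radial_ext_sq; apply: is_derive_sum => j.
have dj : is_derive y (delta_mx k ord0) (radial_ext (fj j)) (sgamma k (fj j) y).
  by apply: derivableP; apply: diff_derivable; have [] := hf j _ y0.
by apply: is_derive_eq; rewrite /GRing.scale /= expr1; ring.
Qed.

Lemma sgamma_sq_ext k y : y != 0 ->
  sgamma k sq y = \sum_(j < m) 2 * radial_ext (fj j) y * sgamma k (fj j) y.
Proof. by move=> y0; have [_] := sq_is_derive k y y0. Qed.

Lemma C1_sphere_sq : C1_sphere sq.
Proof.
move=> y y0; split.
  rewrite radial_ext_sq; apply: differentiable_sum => j.
  by apply: differentiableX; have [] := hf j _ y0.
move=> k.
have E : {near y, (fun y => \sum_(j < m) 2 * radial_ext (fj j) y *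
    sgamma k (fj j) y) =1 sgamma k sq}.
  near=> z; have z0 : z != 0.
    by near: z; apply: open_nbhs_nbhs; split => //; exact: open_neq0.
  by rewrite sgamma_sq_ext.
change (sgamma k sq x @[x --> y] --> sgamma k sq y); rewrite (sgamma_sq_ext k y y0).
apply: cvg_trans (near_eq_cvg E) _.
apply: (@cvg_big R _ +%R _ _ add_continuous _ (nbhs y)) => j _.
have [dj cj] := hf j _ y0.
apply: cvgM; last exact: cj.
apply: cvgM; first exact: cvg_cst.
exact: differentiable_continuous.
Unshelve. all: by end_near.
Qed.

Lemma sgamma_sq k x : S x -> sgamma k sq x = 2 * fgrad k x.
Proof.
move=> Sx; rewrite sgamma_sq_ext; last exact: sphere_neq0.
rewrite mulr_sumr; apply: eq_bigr => j _.
by rewrite radial_ext_sphere// mulrA.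
Qed.

Lemma fj_bounded j : sphere_bounded (fj j).
Proof. exact: C1_sphere_bounded. Qed.

Lemma sgamma_fj_bounded k j : sphere_bounded (sgamma k (fj j)).
Proof. exact: sgamma_bounded. Qed.

Lemma sq_bounded : sphere_bounded sq.
Proof. exact/C1_sphere_bounded/C1_sphere_sq. Qed.

Lemma fgrad_bounded k : sphere_bounded (fgrad k).
Proof.
apply: sphere_bounded_sum => j _; apply: sphere_boundedM; first exact: fj_bounded.
exact: sgamma_fj_bounded.
Qed.

(** Since Gamma_k |f|^2 = 2 sum_j f_j Gamma_k f_j, this is half of the
    divergence theorem for |f|^2. *)
Lemma mean_gradE k : a k ord0 = n%:R / 2 * T k ord0.
Proof.
rewrite /a /T !mxE.
transitivity (sphere_int (fun x => 2^-1 * sgamma k sq x)).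
  apply: eq_sphere_int => x Sx; rewrite sgamma_sq// mulKf ?pnatr_eq0//.
  by rewrite mxE; apply: eq_bigr => j _; rewrite !mxE mulrC.
rewrite sphere_intZ; last exact/sgamma_bounded/C1_sphere_sq.
rewrite sphere_divergence; last exact: C1_sphere_sq.
by rewrite mulrA (mulrC _^-1).
Qed.

Lemma sphere_int_fgrad k : sphere_int (fgrad k) = a k ord0.
Proof.
rewrite /a mxE; apply: eq_sphere_int => x _.
by rewrite mxE; apply: eq_bigr => j _; rewrite !mxE mulrC.
Qed.

Lemma sphere_int_coord_sq k : sphere_int (fun x => x k ord0 * sq x) = T k ord0.
Proof. by rewrite /T mxE. Qed.

Lemma fgrad_radial x : S x -> \sum_k x k ord0 * fgrad k x = 0.
Proof.
move=> Sx; under eq_bigr do rewrite mulr_sumr.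
rewrite exchange_big big1//= => j _.
rewrite (eq_bigr (fun k => fj j x * (x k ord0 * sgamma k (fj j) x))).
  by rewrite -mulr_sumr (sgamma_radial _ (hf j)) ?mulr0 ?sphere_neq0.
by move=> k _; rewrite mulrCA.
Qed.

Lemma coord_sq_bounded k : sphere_bounded (fun x : 'cV[R]_N => x k ord0 * sq x).
Proof. by apply: sphere_boundedM; [exact: sphere_bounded_coord|exact: sq_bounded]. Qed.

Lemma var_xE : var_x f = 1 - fnorm T ^+ 2.
Proof.
rewrite /var_x -/T.
transitivity (sphere_int (fun x =>
  (sq x - 2 * \sum_k T k ord0 * (x k ord0 * sq x)) + fnorm T ^+ 2 * sq x)).
  apply: eq_sphere_int => x Sx; rewrite -/(sq x).
  have -> : fnorm (x - T) ^+ 2 =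
      1 - 2 * (\sum_k T k ord0 * x k ord0) + fnorm T ^+ 2.
    have S1 : 1 = fnorm x ^+ 2 by rewrite Sx expr1n.
    rewrite [X in _ = X - _ + _]S1 !sqr_fnorm_cV mulr_sumr.
    rewrite -sumrB -big_split; apply: eq_bigr => k _ /=; rewrite !mxE; ring.
  rewrite (_ : \sum_k T k ord0 * (x k ord0 * sq x) =
      (\sum_k T k ord0 * x k ord0) * sq x); first by ring.
  by rewrite mulr_suml; apply: eq_bigr => k _; rewrite mulrA.
have lb : sphere_bounded (fun x => \sum_k T k ord0 * (x k ord0 * sq x)).
  by apply: lincomb_bounded => k; exact: coord_sq_bounded.
rewrite sphere_intD; last 2 first.
- by apply: sphere_boundedB; [exact: sq_bounded|exact: sphere_boundedZ].
- by apply: sphere_boundedZ; exact: sq_bounded.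
rewrite sphere_intB; [|exact: sq_bounded|exact: sphere_boundedZ].
rewrite !sphere_intZ//; last exact: sq_bounded.
rewrite sphere_int_lincomb => [|k]; last exact: coord_sq_bounded.
rewrite /sq hf1 mulr1 sqr_fnorm_cV.
rewrite (eq_bigr (fun k => T k ord0 ^+ 2)) => [|k _]; first ring.
by rewrite sphere_int_coord_sq -expr2.
Qed.

Definition grad_dev (x : 'cV[R]_N) : 'M[R]_(N, m) := sgrad f x - a *m f x.

Lemma grad_devE x k j :
  grad_dev x k j = sgamma k (fj j) x - a k ord0 * fj j x.
Proof.
by rewrite [LHS]mxE [X in X + _]mxE [X in _ + X]mxE [X in - X]mxE big_ord1.
Qed.

Definition grad_sq (x : 'cV[R]_N) : R := fnorm (sgrad f x) ^+ 2.

Lemma grad_sqE x : grad_sq x = \sum_k \sum_j sgamma k (fj j) x ^+ 2.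
Proof.
rewrite /grad_sq sqr_fnorm; apply: eq_bigr => k _; apply: eq_bigr => j _.
by rewrite mxE.
Qed.

Lemma grad_sq_bounded : sphere_bounded grad_sq.
Proof.
apply: (@eq_sphere_bounded _ _ (fun x => \sum_k \sum_j sgamma k (fj j) x ^+ 2)).
  by move=> x _; rewrite grad_sqE.
apply: sphere_bounded_sum => k _; apply: sphere_bounded_sum => j _.
by apply: sphere_boundedX; exact: sgamma_fj_bounded.
Qed.

Lemma sqr_grad_dev x : fnorm (grad_dev x) ^+ 2 =
  grad_sq x - 2 * (\sum_k a k ord0 * fgrad k x) + fnorm a ^+ 2 * sq x.
Proof.
rewrite grad_sqE sqr_fnorm sqr_fnorm_cV mulr_sumr -sumrB mulr_suml -big_split.
apply: eq_bigr => k _ /=; rewrite sqE !mulr_sumr -sumrB -big_split.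
by apply: eq_bigr => j _ /=; rewrite grad_devE; ring.
Qed.

Lemma grad_dev_bounded : sphere_bounded (fun x => fnorm (grad_dev x) ^+ 2).
Proof.
under eq_fun do rewrite sqr_grad_dev.
apply: sphere_boundedD; last by apply: sphere_boundedZ; exact: sq_bounded.
apply: sphere_boundedB; first exact: grad_sq_bounded.
by apply: sphere_boundedZ; apply: lincomb_bounded => k; exact: fgrad_bounded.
Qed.

Lemma var_gradE : var_grad f = sphere_int grad_sq - fnorm a ^+ 2.
Proof.
have lb : sphere_bounded (fun x => \sum_k a k ord0 * fgrad k x).
  by apply: lincomb_bounded => k; exact: fgrad_bounded.
rewrite /var_grad (eq_sphere_int _ _ (fun x _ => sqr_grad_dev x)).
rewrite sphere_intD; last 2 first.
- by apply: sphere_boundedB; [exact: grad_sq_bounded|exact: sphere_boundedZ].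
- by apply: sphere_boundedZ; exact: sq_bounded.
rewrite sphere_intB; [|exact: grad_sq_bounded|exact: sphere_boundedZ].
rewrite !sphere_intZ//; last exact: sq_bounded.
rewrite sphere_int_lincomb => [|k]; last exact: fgrad_bounded.
rewrite /sq hf1 mulr1 sqr_fnorm_cV.
rewrite (eq_bigr (fun k => a k ord0 ^+ 2)) => [|k _]; first ring.
by rewrite sphere_int_fgrad -expr2.
Qed.

Lemma sqr_mean_grad : fnorm a ^+ 2 = n%:R ^+ 2 / 4 * fnorm T ^+ 2.
Proof.
rewrite !sqr_fnorm_cV mulr_sumr; apply: eq_bigr => k _; rewrite mean_gradE.
by field.
Qed.

Lemma dist_bounded : sphere_bounded (fun x => fnorm (x - T)).
Proof.
rewrite (_ : (fun _ => _) = fun x : 'cV[R]_N =>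
    Num.sqrt (\sum_k (x k ord0 - T k ord0) ^+ 2)).
  apply: sphere_bounded_sqrt; apply: sphere_bounded_sum => k _.
  apply: sphere_boundedX; apply: sphere_boundedB; last exact: sphere_bounded_cst.
  exact: sphere_bounded_coord.
apply/funext => x; rewrite /fnorm; congr Num.sqrt; apply: eq_bigr => k _.
by rewrite big_ord1 [X in X ^+ 2]mxE [X in (_ + X) ^+ 2]mxE.
Qed.

(** The entry of (grad f - a f) f^T in row k. *)
Definition grad_dev_radial (k : 'I_N) (x : 'cV[R]_N) : R :=
  fgrad k x - a k ord0 * sq x.

Lemma grad_dev_radialE k x :
  grad_dev_radial k x = \sum_j grad_dev x k j * fj j x.
Proof.
rewrite /grad_dev_radial sqE mulr_sumr -sumrB; apply: eq_bigr => j _.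
by rewrite grad_devE; ring.
Qed.

(** Lagrange's identity in each row.  The minors f_l M_kj - f_j M_kl of the
    deviation M = grad f - a f with f are those of grad f, since a f is
    proportional to f in each row. *)
Lemma phase_lagrange x : fnorm (grad_dev x) ^+ 2 * sq x =
  \sum_k grad_dev_radial k x ^+ 2 + (phase_deriv f x * sq x) ^+ 2.
Proof.
have [s0|s0] := eqVneq (sq x) 0.
  rewrite s0 !mulr0 expr0n addr0 big1// => k _.
  rewrite grad_dev_radialE big1 ?expr0n// => j _.
  by rewrite sq_eq0 ?mulr0.
rewrite [in RHS]exprMn /phase_deriv [X in _ = _ + X * _]sqr_sqrtr; last first.
  by do 3 (apply: sumr_ge0 => ? ?); exact: sqr_ge0.
rewrite sqr_fnorm !mulr_suml -big_split; apply: eq_bigr => k _ /=.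
rewrite grad_dev_radialE {1}sqE lagrange_identity; congr (_ + _).
rewrite mulr_suml; apply: eq_bigr => j _; rewrite mulr_suml; apply: eq_bigr => l _.
rewrite -exprMn; congr (_ ^+ 2); rewrite !grad_devE -/(sq x) -/(fj j) -/(fj l).
by field.
Qed.

(** The phase derivative itself may be unbounded near the zeros of f, but
    its product with |f|^2 is controlled by Lagrange's identity. *)
Lemma cov_integrand_bounded :
  sphere_bounded (fun x => fnorm (x - T) * phase_deriv f x * sq x).
Proof.
under eq_fun do rewrite -mulrA.
apply: sphere_boundedM; first exact: dist_bounded.
apply: (@sphere_bounded_le _ _ _ (fun x => 1 + fnorm (grad_dev x) ^+ 2 * sq x)).
- apply: measurable_funM; last by have [] := sq_bounded.
  apply: (@measurableT_comp _ _ _ _ _ _ (@Num.sqrt R)).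
    by apply: continuous_measurable_fun; exact: sqrt_continuous.
  have mF j : measurable_fun S (fun x => fj j x / sq x).
    apply: measurable_funM; first by have [] := fj_bounded j.
    under eq_fun do rewrite -powR_inv1 ?sqr_ge0//.
    by apply: (measurableT_comp (measurable_powR (- 1))); have [] := sq_bounded.
  have mG k j : measurable_fun S (sgamma k (fj j)).
    by have [] := sgamma_fj_bounded k j.
  apply: measurable_sum => k; apply: measurable_sum => j.
  under eq_fun do rewrite big_mkcond /=.
  apply: measurable_sum => l; case: (j < l)%N; last exact: measurable_cst.
  apply: measurable_funX; apply: measurable_funB; exact: measurable_funM.
- apply: sphere_boundedD; first exact: sphere_bounded_cst.
  by apply: sphere_boundedM; [exact: grad_dev_bounded|exact: sq_bounded].
- move=> x _; have p0 : 0 <= phase_deriv f x * sq x.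
    by rewrite mulr_ge0 ?sqr_ge0// sqrtr_ge0.
  rewrite ger0_norm// phase_lagrange.
  have : 0 <= \sum_k grad_dev_radial k x ^+ 2.
    by apply: sumr_ge0 => k _; exact: sqr_ge0.
  move: (phase_deriv f x * sq x) p0 (\sum_k _) => p p0 c c0; nra.
Qed.

Lemma grad_dev_radial_bounded k : sphere_bounded (grad_dev_radial k).
Proof.
apply: sphere_boundedB; first exact: fgrad_bounded.
by apply: sphere_boundedZ; exact: sq_bounded.
Qed.

(** Expanding, x.(f grad f) vanishes and the three other terms integrate to
    - tau.a, - a.tau and tau.a, with a = (n/2) tau. *)
Lemma sphere_int_coupling :
  sphere_int (fun x => \sum_k (x k ord0 - T k ord0) * grad_dev_radial k x) =
  - (n%:R / 2 * fnorm T ^+ 2).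
Proof.
pose F1 x := \sum_k T k ord0 * fgrad k x.
pose F2 (x : 'cV[R]_N) := \sum_k a k ord0 * (x k ord0 * sq x).
pose c := \sum_k T k ord0 * a k ord0.
have F1b : sphere_bounded F1 by apply: lincomb_bounded => k; exact: fgrad_bounded.
have F2b : sphere_bounded F2 by apply: lincomb_bounded => k; exact: coord_sq_bounded.
transitivity (sphere_int (fun x => c * sq x - (F1 x + F2 x))).
  apply: eq_sphere_int => x Sx.
  transitivity (\sum_k (x k ord0 - T k ord0) * grad_dev_radial k x -
      \sum_k x k ord0 * fgrad k x); first by rewrite fgrad_radial// subr0.
  rewrite /c /F1 /F2 mulr_suml -big_split -!sumrB.
  by apply: eq_bigr => k _; rewrite /grad_dev_radial /=; ring.
rewrite sphere_intB; last exact: sphere_boundedD; last first.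
  by apply: sphere_boundedZ; exact: sq_bounded.
rewrite sphere_intZ ?sphere_intD//; last exact: sq_bounded.
rewrite !sphere_int_lincomb; [|exact: coord_sq_bounded|exact: fgrad_bounded].
rewrite hf1 sqr_fnorm_cV mulr_sumr mulr1 -sumrN -big_split -sumrB.
apply: eq_bigr => k _ /=; rewrite sphere_int_fgrad sphere_int_coord_sq mean_gradE.
ring.
Qed.

(** Integrating the pointwise bound gives 2 t D <= t^2 D V_x + V_grad for
    t >= 0; the optimal t is 1/V_x. *)
Lemma spherical_uncertainty :
  n%:R ^+ 2 / 4 * fnorm T ^+ 4 + cov f ^+ 2 <= var_x f * var_grad f.
Proof.
pose u (x : 'cV[R]_N) := \sum_k (x k ord0 - T k ord0) * grad_dev_radial k x.
pose w (x : 'cV[R]_N) := fnorm (x - T) * phase_deriv f x * sq x.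
pose P (x : 'cV[R]_N) := fnorm (x - T) ^+ 2 * sq x.
pose Q (x : 'cV[R]_N) := fnorm (grad_dev x) ^+ 2.
have ub : sphere_bounded u.
  apply: sphere_bounded_sum => k _; apply: sphere_boundedM.
    by apply: sphere_boundedB; [exact: sphere_bounded_coord|exact: sphere_bounded_cst].
  exact: grad_dev_radial_bounded.
have wb : sphere_bounded w := cov_integrand_bounded.
have Pb : sphere_bounded P.
  apply: sphere_boundedM; last exact: sq_bounded.
  by apply: sphere_boundedX; exact: dist_bounded.
have Qb : sphere_bounded Q := grad_dev_bounded.
pose A := sphere_int u.
pose B := cov f.
pose D := A ^+ 2 + B ^+ 2.
have sq_ge0 x : 0 <= sq x by exact: sqr_ge0.
have pointwise t x : 0 <= t ->
    2 * t * (A * u x + B * w x) <= t ^+ 2 * D * P x + Q x.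
  move=> t0.
  have lag : Q x * sq x = _ := phase_lagrange x.
  pose c := \sum_k grad_dev_radial k x ^+ 2.
  have c0 : 0 <= c by apply: sumr_ge0 => k _; exact: sqr_ge0.
  have uc : u x ^+ 2 <= fnorm (x - T) ^+ 2 * c.
    rewrite sqr_fnorm_cV; apply: le_trans (cauchy_schwarz_sum _ _ _) _.
    rewrite ler_wpM2r//; apply: ler_sum => k _.
    by rewrite [X in _ <= X ^+ 2]mxE [X in _ <= (_ + X) ^+ 2]mxE.
  have := coupling_bound (t * sq x) A B _ _ _ (phase_deriv f x * sq x) c0 uc.
  rewrite -lag -/D => main.
  have [s0|s0] := eqVneq (sq x) 0.
    have cE : c = 0.
      rewrite /c big1// => k _; rewrite grad_dev_radialE big1 ?expr0n// => j _.
      by rewrite sq_eq0 ?mulr0.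
    have u0 : u x = 0.
      by apply/eqP; rewrite -sqrf_eq0 eq_le sqr_ge0 andbT; move: uc; rewrite cE mulr0.
    by rewrite u0 /w /P s0 !mulr0 addr0 mulr0 add0r sqr_ge0.
  have sp : 0 < sq x by rewrite lt_def s0 sq_ge0.
  rewrite -(ler_pM2r sp) -subr_ge0; move: main; rewrite -subr_ge0.
  by congr (_ <= _); rewrite /w /P; ring.
have DE t : 0 <= t -> 2 * t * D <= t ^+ 2 * D * var_x f + var_grad f.
  move=> t0.
  have := @le_sphere_int _ _ (fun x => 2 * t * (A * u x + B * w x))
    (fun x => t ^+ 2 * D * P x + Q x) _ _ (fun x _ => pointwise t x t0).
  have Aub : sphere_bounded (fun x => A * u x) by exact: sphere_boundedZ.
  have Bwb : sphere_bounded (fun x => B * w x) by exact: sphere_boundedZ.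
  have tPb : sphere_bounded (fun x => t ^+ 2 * D * P x) by exact: sphere_boundedZ.
  rewrite sphere_intZ ?sphere_intD ?sphere_intZ//; last exact: sphere_boundedD.
  rewrite -!expr2; apply; last exact: sphere_boundedD.
  by apply: sphere_boundedZ; exact: sphere_boundedD.
have Vx0 : 0 <= var_x f.
  have -> : 0 = sphere_int (fun _ : 'cV[R]_N => 0 * 0 : R).
    by rewrite sphere_intZ ?mul0r//; exact: sphere_bounded_cst.
  apply: le_sphere_int; [exact: sphere_bounded_cst|exact: Pb|].
  by move=> x _; rewrite mul0r mulr_ge0// sqr_ge0.
have Vg0 : 0 <= var_grad f by have := DE 0 (lexx _); rewrite expr0n mulr0 !mul0r add0r.
have D0 : 0 <= D by rewrite addr_ge0// sqr_ge0.
have -> : n%:R ^+ 2 / 4 * fnorm T ^+ 4 + cov f ^+ 2 = D.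
  rewrite /D /A /u sphere_int_coupling /B; congr (_ + _).
  by field.
have [V0|V0] := eqVneq (var_x f) 0.
  rewrite V0 mul0r leNgt; apply/negP => Dp.
  have := DE ((var_grad f + 1) / D); rewrite V0 mulr0 add0r mulrA divfK ?gt_eqF//.
  have t0 : 0 <= (var_grad f + 1) / D by rewrite divr_ge0// addr_ge0.
  by move=> /(_ t0); lra.
have Vp : 0 < var_x f by rewrite lt_def V0.
have := DE (var_x f)^-1; rewrite invr_ge0 => /(_ Vx0).
rewrite -(ler_pM2r Vp) => h; rewrite -subr_ge0; move: h; rewrite -subr_ge0.
congr (_ <= _); field.
by rewrite gt_eqF.
Qed.

End uncertainty.

Theorem theorem1p16 (R : realType) (n m : nat) (hn : (2 <= n)%N)
    (f : 'cV[R]_n.+1 -> 'rV[R]_m)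
    (hf : forall j : 'I_m, C1_sphere (comp_fun f j))
    (hf1 : sphere_int (fun x => fnorm (f x) ^+ 2) = 1) :
  var_x f * var_grad f >=
    n%:R ^+ 2 / 4 * fnorm (tau f) ^+ 4 + cov f ^+ 2
  /\
  (var_x f * var_grad f >=
     n%:R ^+ 2 / 4 * fnorm (tau f) ^+ 4 + cov f ^+ 2
   <->
   var_x f * sphere_int (fun x => fnorm (sgrad f x) ^+ 2) >=
     n%:R ^+ 2 / 4 * fnorm (tau f) ^+ 2 + cov f ^+ 2).
Proof.
have main := spherical_uncertainty f hf hf1.
split=> //; have := main; rewrite (var_gradE f hf hf1) (var_xE f hf hf1).
rewrite (sqr_mean_grad f hf) /grad_sq.
move: (sphere_int _) (fnorm (tau f)) (cov f ^+ 2) (n%:R) => I t c N _.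
have E : (1 - t ^+ 2) * (I - N ^+ 2 / 4 * t ^+ 2) - (N ^+ 2 / 4 * t ^+ 4 + c) =
    (1 - t ^+ 2) * I - (N ^+ 2 / 4 * t ^+ 2 + c) by field.
by split; rewrite -subr_ge0 => h; rewrite -subr_ge0; move: h; rewrite E.
Qed.
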